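(* Let $\mathbb K=\mathbb F_q$, let $Y$ be a subset of $T_X$ and let $[P]\in T_X$. (i) If $I(Y)=I_L$ then $I([P]Y)=\langle \mathbf x^{\mathbf m^+}-\mathbf x^{\mathbf m}(P)\,\mathbf x^{\mathbf m^-} : \mathbf m\in L\rangle$. (ii) $I([P])=\langle \mathbf x^{\mathbf m^+}-\mathbf x^{\mathbf m}(P)\,\mathbf x^{\mathbf m^-} : \mathbf m\in L_\beta\rangle$ is a prime ideal of height $n$. (iii) The minimal primary decomposition of $I(Y)$ is $I(Y)=\bigcap_{[P]\in Y}I([P])$. (iv) $I(Y)$ is radical. (v) $\operatorname{height} I(Y)=n$. (vi) $\dim I(Y)=r-n$.
   Context: Setting. $X$ is a complete simplicial toric variety over a field $\mathbb K$ given by a fan $\Sigma\subset\mathbb R^n$ with rays $\rho_1,\dots,\rho_r$ and corresponding primitive lattice generators $\mathbf v_1,\dots,\mathbf v_r\in\mathbb Z^n$. The matrix $\phi:\mathbb Z^n\to\mathbb Z^r$ has rows $\mathbf v_1,\dots,\mathbf v_r$, and there is an exact sequence $0\to\mathbb Z^n\xrightarrow{\phi}\mathbb Z^r\xrightarrow{\beta}\mathcal A\to 0$ with $\mathcal A\cong \mathrm{Cl}(X)$. The order of the torsion part of $\mathcal A$ is assumed coprime to the characteristic of $\mathbb K$. The Cox ring $S=\mathbb K[x_1,\dots,x_r]$ is graded by $\mathcal A$ via $\deg x_j=\beta_j:=\beta(e_j)$, where $e_j$ is the $j$-th standard basis vector of $\mathbb Z^r$; ''homogeneous'' for polynomials refers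 to this grading. Let $\mathbf u_1,\dots,\mathbf u_n\in\mathbb Z^r$ be the columns of $\phi$, write $\mathbf t^{\mathbf u}=t_1^{u_1}\cdots t_r^{u_r}$, let $\pi:(\mathbb K^* )^r\to T_X\cong(\mathbb K^* )^n$, $\pi(\mathbf t)=[\mathbf t^{\mathbf u_1}:\cdots:\mathbf t^{\mathbf u_n}]$, and $G=\ker\pi$. The torus $T_X$ is split and $1\to G\to(\mathbb K^* )^r\xrightarrow{\pi}T_X\to1$ is exact, so $T_X\cong(\mathbb K^* )^r/G$. For $P\in(\mathbb K^* )^r$, $[P]=G\cdot P$; the group law is coordinatewise, $[P][P']=[PP']$, and $[P]Y=\{[P][P'] : [P']\in Y\}$. For $Y\subseteq T_X$, $I(Y)\subseteq S$ is the ideal generated by the homogeneous polynomials vanishing on $Y$, and $I([P])=I(\{[P]\})$. A lattice is a subgroup $L\subseteq\mathbb Z^r$, and $L_\beta:=\operatorname{Ker}\beta=\operatorname{Im}\phi$. Write $\mathbf m=\mathbf m^+-\mathbf m^-$ with $\mathbf m^{\pm}\in\mathbb N^r$ the positive and negative parts; the lattice ideal of $L$ is $I_L=\langle \mathbf x^{\mathbf m^+}-\mathbf x^{\mathbf m^-} : \mathbf m\in L\rangle$. $\mathbf x^{\mathbf m}(P)$ is the value of the Laurent monomial $\mathbf x^{\mathbf m}$ at $P$ (for $\mathbf m\in L_\beta$ it depends only on $[P]$). $\dim I(Y)$ means the Krull dimension of $S/I(Y)$.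
   Formalization: ''Prime'' in (ii) and ''primary decomposition'' in (iii) are proved in the ordinary sense only when Cl(X) is torsion-free (with torsion I([P]) is never prime or primary); in general they are proved in the A-graded sense. (v) and (vi) assume Y nonempty. *)

(* Defs.v *)
From HB Require Import structures.
From mathcomp Require Import all_boot all_order all_fingroup all_algebra.
From mathcomp Require Import mpoly.
From mathcomp Require Import boolp classical_sets reals.

Set Implicit Arguments.
Unset Strict Implicit.
Unset Printing Implicit Defensive.

Import GRing.Theory Num.Theory.
Local Open Scope ring_scope.

(* -------------------------------------------------------------------- *)
(* Ideals are not required to be proper: the vanishing ideal of the empty
   set is the whole ring. *)
Section Ideals.
Variable R : comNzRingType.
Implicit Types (I J p Q : set R) (c : nat -> set R).

Definition ideal I : Prop :=
  [/\ I 0, forall f g, I f -> I g -> I (f + g) & forall h f, I f -> I (h * f)].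

Definition ideal_gen (E : set R) : set R := smallest ideal E.

Definition prime_ideal p : Prop :=
  [/\ ideal p, ~ p 1 & forall f g, p (f * g) -> p f \/ p g].

Definition primary_ideal Q : Prop :=
  [/\ ideal Q, ~ Q 1
    & forall f g, Q (f * g) -> Q f \/ exists k : nat, Q (g ^+ k)].

Definition radical I : set R := fun f => exists k : nat, I (f ^+ k).

Definition is_radical I : Prop := radical I = I.

Definition prime_chain c (k : nat) : Prop :=
  (forall i, (i <= k)%N -> prime_ideal (c i)) /\
  (forall i, (i < k)%N -> (c i `<` c i.+1)%classic).

Definition prime_height_is p (h : nat) : Prop :=
  (exists2 c, prime_chain c h & c h = p) /\
  (forall c k, prime_chain c k -> c k = p -> (k <= h)%N).

(* The primes above I that have infinite height impose no constraint. *)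
Definition height_is I (h : nat) : Prop :=
  (exists p, [/\ prime_ideal p, (I `<=` p)%classic & prime_height_is p h]) /\
  (forall p k, prime_ideal p -> (I `<=` p)%classic -> prime_height_is p k ->
     (h <= k)%N).

(* Notions relative to a grading, given by the set H of its homogeneous
   elements.  If the grading group has torsion, a graded prime ideal need not
   be prime: it is prime when only homogeneous elements are tested. *)
Definition homogeneous_ideal (H : set R) I : Prop :=
  I = ideal_gen (I `&` H)%classic.

Definition graded_prime_ideal (H : set R) p : Prop :=
  [/\ homogeneous_ideal H p, ~ p 1
    & forall f g, H f -> H g -> p (f * g) -> p f \/ p g].

Definition graded_primary_ideal (H : set R) Q : Prop :=
  [/\ homogeneous_ideal H Q, ~ Q 1
    & forall f g, H f -> H g -> Q (f * g) ->
        Q f \/ exists k : nat, Q (g ^+ k)].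

Definition graded_radical (H : set R) I : set R :=
  ideal_gen (radical I `&` H)%classic.

Definition minimal_decomposition
    (primary : set R -> Prop) (rad : set R -> set R)
    (T : finType) (D : {set T}) (Q : T -> set R) I : Prop :=
  [/\ I = (\bigcap_(i in [set` D]) Q i)%classic,
      forall i, i \in D -> primary (Q i),
      forall i j, i \in D -> j \in D -> rad (Q i) = rad (Q j) -> i = j
    & forall i, i \in D ->
        ~ (\bigcap_(j in [set` D :\ i]) Q j `<=` Q i)%classic].

Definition the_minimal_decomposition
    (primary : set R -> Prop) (rad : set R -> set R)
    (T : finType) (D : {set T}) (Q : T -> set R) I : Prop :=
  minimal_decomposition primary rad D Q I /\
  (forall (k : nat) (Q' : 'I_k -> set R),
     minimal_decomposition primary rad [set: 'I_k]%SET Q' I ->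
     forall J, (exists i, Q' i = J) <-> (exists2 i, i \in D & Q i = J)).

Definition the_minimal_primary_decomposition :=
  the_minimal_decomposition primary_ideal radical.

Definition the_minimal_graded_primary_decomposition (H : set R) :=
  the_minimal_decomposition (graded_primary_ideal H) (graded_radical H).

End Ideals.

Definition krull_dim_is (R : comNzRingType) (d : nat) : Prop :=
  (exists c : nat -> set R, prime_chain c d) /\
  (forall (c : nat -> set R) k, prime_chain c k -> (k <= d)%N).

(* The library forms R/I only for a bundled proper ideal J with boolean
   membership; J is the ideal I in that form. *)
Definition quotient_krull_dim_is (R : comNzRingType) (I : set R) (d : nat) :
    Prop :=
  exists J : idealr R,
    (forall f, f \in J <-> I f) /\ krull_dim_is {ideal_quot J} d.

(* -------------------------------------------------------------------- *)
(* The rays of the fan are spanned by the rows of phi.  Every cone of a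
   simplicial fan is determined by the set of its rays and its faces are the
   cones on the subsets, so the fan is encoded by a set of subsets of 'I_r. *)
Section Fan.
Variables (R : realType) (n r : nat) (phi : 'M[int]_(r, n)).

Definition ray_gen (i : 'I_r) : 'rV[R]_n := map_mx intr (row i phi).

Definition cone (s : {set 'I_r}) : set 'rV[R]_n :=
  fun w => exists2 a : 'I_r -> R,
    (forall i, 0 <= a i) & w = \sum_(i in s) a i *: ray_gen i.

Record complete_simplicial_fan (Sigma : {set {set 'I_r}}) : Prop :=
  CompleteSimplicialFan {
  fan_primitive : forall i, \big[gcdn/0%N]_(j < n) `|phi i j|%N = 1%N;
  fan_rays : forall i, [set i]%SET \in Sigma;
  fan_faces : forall s t : {set 'I_r}, s \in Sigma -> t \subset s ->
    t \in Sigma;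
  fan_meet : forall s t : {set 'I_r}, s \in Sigma -> t \in Sigma ->
    (cone s `&` cone t)%classic = cone (s :&: t);
  fan_simplicial : forall s : {set 'I_r}, s \in Sigma ->
    forall a : 'I_r -> R, \sum_(i in s) a i *: ray_gen i = 0 ->
    forall i, i \in s -> a i = 0;
  fan_complete : forall w : 'rV[R]_n, exists2 s, s \in Sigma & cone s w
}.
End Fan.

(* -------------------------------------------------------------------- *)
Section ClassGroup.
Variables (n r : nat) (A : zmodType).

Definition class_group_sequence (phi : 'M[int]_(r, n))
    (beta : {additive 'cV[int]_r -> A}) : Prop :=
  [/\ injective (fun c : 'cV[int]_n => phi *m c),
      forall m, beta m = 0 <-> exists c : 'cV[int]_n, m = phi *m c
    & forall a, exists m, beta m = a].

Definition torsion_elt (a : A) : Prop := exists2 k : nat, (0 < k)%N & a *+ k = 0.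

Definition torsion_order_is (N : nat) : Prop :=
  exists s : seq A,
    [/\ uniq s, forall a, a \in s <-> torsion_elt a & size s = N].

Definition torsion_free : Prop := forall a : A, torsion_elt a -> a = 0.

Definition Lbeta (beta : {additive 'cV[int]_r -> A}) : {pred 'cV[int]_r} :=
  [pred m | beta m == 0].

Variable K : finFieldType.

Definition homogeneous (beta : {additive 'cV[int]_r -> A}) :
    set {mpoly K[r]} :=
  fun f => exists a : A, forall m : 'X_{1..r}, m \in msupp f ->
    \sum_(j < r) beta (delta_mx j 0) *+ m j = a.

End ClassGroup.

Arguments homogeneous {r A} K beta _.

(* -------------------------------------------------------------------- *)
Section Torus.
Variables (K : finFieldType) (n r : nat) (phi : 'M[int]_(r, n)).

(* (K^* )^r, with the coordinatewise group law of the library *)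
Definition torus : finGroupType := {dffun forall i : 'I_r, {unit K}}.

Definition laurent_mon (m : 'cV[int]_r) (P : torus) : K :=
  \prod_(i < r) (val (P i) : K) ^ (m i 0).

Definition torus_pi (P : torus) : 'rV[K]_n :=
  \row_j laurent_mon (col j phi) P.

Definition Gset : {set torus} := [set P | torus_pi P == const_mx 1]%SET.

Lemma laurent_mon1 m : laurent_mon m 1%g = 1.
Proof. by rewrite /laurent_mon big1 // => i _; rewrite ffunE /= exp1rz. Qed.

Lemma laurent_monM m P P' :
  laurent_mon m (P * P')%g = laurent_mon m P * laurent_mon m P'.
Proof.
rewrite /laurent_mon -big_split /=; apply: eq_bigr => i _.
by rewrite ffunE /= expfzMl.
Qed.

Lemma Gset_group_set : group_set Gset.
Proof.
apply/group_setP; split=> [|P P'].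
  by rewrite inE; apply/eqP/rowP => j; rewrite !mxE laurent_mon1.
rewrite !inE => /eqP /rowP h /eqP /rowP h'; apply/eqP/rowP => j.
by have := h j; have := h' j; rewrite !mxE laurent_monM => -> ->; rewrite mulr1.
Qed.

Canonical Ggrp : {group torus} := Group Gset_group_set.

Definition TX : finGroupType := coset_of Ggrp.

Definition pt (P : torus) : TX := coset Ggrp P.

(* The library's cosets live over the normaliser of Ggrp; the torus being
   abelian, that is everything, and pt P is the orbit of P under Ggrp. *)
Lemma torus_mulC (P P' : torus) : (P * P')%g = (P' * P)%g.
Proof. by apply/ffunP => i; rewrite !ffunE; apply: val_inj; apply: mulrC. Qed.

Lemma ptE P : pt P = (Ggrp :* P)%g :> {set torus}.
Proof.
apply: val_coset; rewrite inE; apply/fintype.subsetP => Q /imsetP[P' GP' ->].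
by rewrite conjgE torus_mulC mulgK.
Qed.

Definition translate (C : TX) (Y : {set TX}) : {set TX} :=
  [set (C * D)%g | D in Y]%SET.

Definition vanishes_at (f : {mpoly K[r]}) (C : TX) : Prop :=
  forall P : torus, P \in C -> f.@[fun i => val (P i)] = 0.

Definition vanishing_ideal (A : zmodType)
    (beta : {additive 'cV[int]_r -> A}) (Y : {set TX}) : set {mpoly K[r]} :=
  ideal_gen (fun f => homogeneous K beta f /\
                      forall C, C \in Y -> vanishes_at f C).

End Torus.

(* -------------------------------------------------------------------- *)
Section LatticeIdeals.
Variables (K : finFieldType) (r : nat).

Definition pos_part (m : 'cV[int]_r) : 'X_{1..r} :=
  [multinom (if 0 <= m j 0 then `|m j 0%R|%N else 0%N)%R | j < r].

Definition neg_part (m : 'cV[int]_r) : 'X_{1..r} :=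
  [multinom (if m j 0 <= 0 then `|m j 0%R|%N else 0%N)%R | j < r].

Definition lattice_ideal (L : {pred 'cV[int]_r}) : set {mpoly K[r]} :=
  ideal_gen (fun f => exists2 m, m \in L & f = 'X_[pos_part m] - 'X_[neg_part m]).

Definition twisted_lattice_ideal (L : {pred 'cV[int]_r}) (P : torus K r) :
    set {mpoly K[r]} :=
  ideal_gen (fun f => exists2 m, m \in L &
    f = 'X_[pos_part m] - laurent_mon m P *: 'X_[neg_part m]).

End LatticeIdeals.

(* Main.v *)
Require Import Defs.
From HB Require Import structures.
From mathcomp Require Import boolp classical_sets.
From mathcomp Require Import all_boot all_order all_fingroup all_algebra.
From mathcomp Require Import mpoly.
From mathcomp Require Import reals.
From mathcomp Require ssrcomplements.
From mathcomp Require Import finfield zify.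

(** Why the theorem holds.

    For a lattice L, a point P of the torus of S and an integer vector z, the
    class sum of a polynomial f is the sum of f_m P^m over the exponents m
    congruent to z modulo L.  It is the coefficient of the class of z in the
    image of f in the group algebra K[Z^r / L], under the map x^m |-> P^m [m].
    All the ideals of the theorem are described by class sums.  The twisted
    lattice ideal of L at P is the kernel of that map, because modulo its
    binomials the monomials of one class are multiples of each other
    (twisted_lattice_idealE).  The ideal I(Y) consists of the f whose class sums
    for the lattice of the grading vanish at all points of Y, because the value
    of a homogeneous component at a point is a class sum (vanishing_idealE).
    Part (i), the generators in (ii) and the intersection in (iii) follow by
    comparing class sums; for (i) one substitutes P_i x_i for x_i.

    Homogeneous elements of I([P]) are those with value 0 at P, so I([P]) is a
    graded prime ideal.  When the class group is torsion free, an additive form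
    separating the finitely many classes at hand makes top classes multiply, as
    degrees do, and I([P]) is prime (twisted_prime).  In general I(Y) is radical
    by Frobenius: multiplication by the characteristic p is injective on the
    class group, so the class sum of f^p at p z is the p-th power of that of f at
    z (class_sum_Frobenius).  The uniqueness of the decomposition is the
    classical argument for an intersection of incomparable primes
    (the_minimal_decomposition_of_primes).

    Heights and dimensions are read off from explicit chains.  Complete the
    columns of phi to r independent vectors v_0, v_1, ... and let L_i be the span
    of the first i, so that L_n is the lattice of the grading.  The binomial of
    v_i lies in the twisted ideal of L_(i+1), and it is a nonzerodivisor modulo
    that of L_i because v_i has infinite order modulo L_i (binomial_regular).
    Hence, below every prime containing the ideal of L_b, one can descend b - a
    strict steps through primes containing the ideal of L_a
    (prime_chain_of_regular).  From L_n to L_0 this gives a chain of length n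
    below every prime containing I([P]); from L_r to L_n, starting at the
    polynomials vanishing at P, it gives a chain of length r - n above I([P]).  As
    prime chains of K[x_1, ..., x_r] have length at most r
    (prime_chain_mpoly_le), both lengths are optimal.  The latter bound is proved
    by counting monomials: a chain of length k produces k algebraically
    independent polynomials. *)

Set Implicit Arguments.
Unset Strict Implicit.
Unset Printing Implicit Defensive.

Import GRing.Theory Num.Theory.
Local Open Scope ring_scope.

(** * Ideals, primes and chains of primes *)

Section IdealTheory.
Variable R : comNzRingType.
Implicit Types (I J p q : set R) (c : nat -> set R) (E H U : set R).

Lemma idealN I f : ideal I -> I f -> I (- f).
Proof. by case=> _ _ IM If; rewrite -mulN1r; apply: IM. Qed.

Lemma idealBr I f g : ideal I -> I (f - g) -> I g -> I f.
Proof. by case=> _ ID _ Ifg Ig; rewrite -(subrK g f); apply: ID. Qed.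

Lemma ideal_sum I (T : Type) (s : seq T) (P : pred T) (F : T -> R) :
  ideal I -> (forall i, P i -> I (F i)) -> I (\sum_(i <- s | P i) F i).
Proof. by case=> I0 ID _ IF; apply: big_ind. Qed.

Lemma ideal_gen_ideal E : ideal (ideal_gen E).
Proof.
split.
- by move=> J [[]].
- by move=> f g Ef Eg J EJ; case: (EJ) => -[_ JD _] _; apply: JD; [apply: Ef|apply: Eg].
- by move=> h f Ef J EJ; case: (EJ) => -[_ _ JM] _; apply: JM; apply: Ef.
Qed.

Lemma mem_ideal_gen E f : E f -> ideal_gen E f.
Proof. by move=> Ef J [_]; apply. Qed.

Lemma ideal_gen_min E I : ideal I -> (E `<=` I)%classic -> (ideal_gen E `<=` I)%classic.
Proof. exact: smallest_sub. Qed.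

Lemma ideal_gen_id I : ideal I -> ideal_gen I = I.
Proof. exact: smallest_id. Qed.

(** An ideal maximal among those containing J and disjoint from a
    multiplicative set U is prime: ideals strictly larger than it meet U, and
    so does the product of two of them.  Zorn is applied to the sets X whose
    union with J is such an ideal, so that the empty chain has J as its upper
    bound. *)
Lemma prime_disjoint J U :
    ideal J -> U 1 -> (forall f g, U f -> U g -> U (f * g)) ->
    (forall f, J f -> ~ U f) ->
  exists p, [/\ prime_ideal p, (J `<=` p)%classic & forall f, p f -> ~ U f].
Proof.
move=> idJ U1 UM JU.
pose P (X : set R) := ideal (X `|` J)%classic /\ forall f, (X `|` J)%classic f -> ~ U f.
have [F FP Ftot|A [[idA AU] Amax]] := @Zorn_bigcup _ P.
  have wit f : (\bigcup_(X in F) X `|` J)%classic f ->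
      J f \/ exists2 X, F X & (X `|` J)%classic f.
    by case=> [[X FX Xf]|Jf]; [right; exists X => //; left|left].
  have sub X f : F X -> (X `|` J)%classic f -> (\bigcup_(X in F) X `|` J)%classic f.
    by move=> FX [Xf|Jf]; [left; exists X|right].
  case: (idJ) => J0 JD JM; split; first split; first by right.
  - move=> f g /wit[Jf|[X FX Xf]] /wit[Jg|[X' FX' Xg]]; first by right; apply: JD.
    + by apply: (sub X') => //; have [[_ ID _] _] := FP _ FX'; apply: ID => //; right.
    + by apply: (sub X) => //; have [[_ ID _] _] := FP _ FX; apply: ID => //; right.
    + have [XX'|X'X] := Ftot _ _ FX FX'.
        apply: (sub X') => //; have [[_ ID _] _] := FP _ FX'; apply: ID => //.
        by case: Xf => [/XX' ?|?]; [left|right].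
      apply: (sub X) => //; have [[_ ID _] _] := FP _ FX; apply: ID => //.
      by case: Xg => [/X'X ?|?]; [left|right].
  - move=> h f /wit[Jf|[X FX Xf]]; first by right; apply: JM.
    by apply: (sub X) => //; have [[_ _ IM] _] := FP _ FX; apply: IM.
  - move=> f /wit[/JU //|[X FX Xf]]; have [_] := FP _ FX; exact.
pose q := (A `|` J)%classic.
have Jq : (J `<=` q)%classic by move=> f; right.
exists q; split=> //; split=> //; first by move=> /AU.
(* By maximality, the ideal generated by q and any f outside q meets U. *)
have ext f : ~ q f -> exists2 u, U u & exists2 g, q g & exists h, u = g + h * f.
  move=> qf; apply: contrapT => noU.
  pose B := [set x | exists2 g, q g & exists h, x = g + h * f]%classic.
  have qB : (q `<=` B)%classic by move=> x qx; exists x => //; exists 0; rewrite mul0r addr0.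
  have Bf : B f by exists 0; [case: idA|exists 1; rewrite add0r mul1r].
  have BJ : (B `|` J)%classic = B by apply/seteqP; split=> x; [case=> // /Jq/qB|left].
  have AB : (A `<` B)%classic.
    split; last by move=> BA; apply: qf; left; apply: BA.
    by move=> x Ax; apply: qB; left.
  apply: (Amax B AB).
  case: idA => q0 qD qM; rewrite /P BJ; split; first split; first exact: qB.
  - move=> _ _ [g qg [h ->]] [g' qg' [h' ->]]; exists (g + g'); first exact: qD.
    by exists (h + h'); rewrite mulrDl addrACA.
  - move=> k _ [g qg [h ->]]; exists (k * g); first exact: qM.
    by exists (k * h); rewrite mulrDr mulrA.
  - by move=> x [g qg [h xE]] Ux; apply: noU; exists x => //; exists g => //; exists h.
move=> f g qfg; apply: contrapT => /not_orP[/ext[u Uu [a qa [h uE]]] /ext[v Uv [b qb [k vE]]]].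
apply: (AU (u * v)); last exact: UM.
case: idA => q0 qD qM; rewrite uE vE mulrDl; apply: (qD); first by rewrite mulrC; apply: qM.
rewrite mulrDr; apply: (qD); first exact: qM.
by rewrite mulrACA; apply: qM.
Qed.

(** The multiplicative set of all s h^k with s outside q misses J, because h can
    be cancelled modulo J and J lies in q.  This replaces a minimal prime of J
    inside q, which likewise cannot contain a nonzerodivisor modulo J. *)
Lemma prime_of_nonzerodivisor J h q :
    ideal J -> (forall s, J (s * h) -> J s) -> prime_ideal q -> (J `<=` q)%classic ->
  exists p, [/\ prime_ideal p, (J `<=` p)%classic, (p `<=` q)%classic & ~ p h].
Proof.
move=> idJ Jh [idq q1 qM] Jq.
pose U := [set x | exists2 s, ~ q s & exists k : nat, x = s * h ^+ k]%classic.
have [||||p [prp Jp pU]] := @prime_disjoint J U => //.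
- by exists 1 => //; exists 0%N; rewrite mulr1.
- move=> _ _ [s qs [k ->]] [t qt [l ->]]; exists (s * t); first by case/qM.
  by exists (k + l)%N; rewrite mulrACA exprD.
- move=> f Jf [s qs [k fE]]; apply: qs; apply: Jq; move: Jf; rewrite fE.
  by elim: k {fE} => [|k IHk]; rewrite ?mulr1 // exprSr mulrA => /Jh.
exists p; split=> //.
  move=> f pf; apply: contrapT => qf; apply: (pU f pf); exists f => //.
  by exists 0%N; rewrite mulr1.
by move=> ph; apply: (pU h ph); exists 1 => //; exists 1%N; rewrite mul1r.
Qed.

(** The easy half of dimension theory: along an increasing family of ideals in
    which each J (i+1) contains a nonzerodivisor h i modulo J i, one descends
    from a prime above the last ideal one step at a time, each new prime
    containing J i but not h i and hence being strictly smaller. *)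
Lemma prime_chain_of_regular (J : nat -> set R) (h : nat -> R) (a k : nat) p :
    (forall i, (a <= i <= a + k)%N -> ideal (J i)) ->
    (forall i, (a <= i < a + k)%N ->
      [/\ (J i `<=` J i.+1)%classic, J i.+1 (h i) & forall s, J i (s * h i) -> J i s]) ->
    prime_ideal p -> (J (a + k)%N `<=` p)%classic ->
  exists c, [/\ prime_chain c k, c k = p & (J a `<=` c 0%N)%classic].
Proof.
move=> idJ regJ prp; elim: k a idJ regJ => [|k IHk] a idJ regJ Jp.
  by exists (fun=> p); rewrite addn0 in Jp; split=> //; split=> // i; rewrite ltn0.
have [|||c [[prc ltc] ck Jc]] := IHk a.+1.
- by move=> i /andP[ai ib]; apply: idJ; rewrite (ltnW ai) addnS -addSn.
- by move=> i /andP[ai ib]; apply: regJ; rewrite (ltnW ai) addnS -addSn.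
- by rewrite addSn -addnS.
have [|JJ Jh nzd] := regJ a; first by rewrite leqnn addnS ltnS leq_addr.
have [||||q [prq Jq qc qh]] := @prime_of_nonzerodivisor (J a) (h a) (c 0%N) => //.
- by apply: idJ; rewrite leqnn leq_addr.
- exact: prc.
- by move=> f /JJ/Jc.
exists (fun i => if i is i'.+1 then c i' else q); split=> //; split=> [[|i]|[|i]] //=.
- exact: prc.
- by move=> _; split=> // cq; apply: qh; apply: cq; apply: Jc.
- exact: ltc.
Qed.

Lemma prime_chain_cat c c' (a b : nat) :
  prime_chain c a -> prime_chain c' b -> c a = c' 0%N ->
  exists d, [/\ prime_chain d (a + b), d 0%N = c 0%N & d (a + b)%N = c' b].
Proof.
move=> [prc ltc] [prc' ltc'] cc'.
exists (fun i => if (i <= a)%N then c i else c' (i - a)%N); split=> //; first split.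
- move=> i ib; case: leqP => [/prc//|ai]; apply: prc'; by rewrite leq_subLR.
- move=> i ib; case: (ltngtP i a) => [ia|ai|ia].
  + exact: ltc.
  + by rewrite subSn ?(ltnW ai) //; apply: ltc'; rewrite ltn_subLR // ltnW.
  + rewrite ia cc' subSnn; apply: ltc'; by rewrite ia -[X in (X < _)%N]addn0 ltn_add2l in ib.
- case: leqP => [|_]; last by rewrite addKn.
  by rewrite -[X in (_ <= X)%N]addn0 leq_add2l leqn0 => /eqP ->; rewrite addn0.
Qed.

End IdealTheory.

(** * Minimal decompositions and dimension of a quotient *)

Section MinimalDecompositions.
Variables (R : comNzRingType) (H : set R).
Hypotheses (H1 : H 1) (HM : forall f g, H f -> H g -> H (f * g)).
Implicit Types (I J p q : set R).

Lemma homogeneous_idealP I : homogeneous_ideal H I -> ideal I.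
Proof. by move=> ->; apply: ideal_gen_ideal. Qed.

Lemma homogeneous_ideal_sub I J :
    homogeneous_ideal H I -> ideal J -> (forall f, I f -> H f -> J f) ->
  (I `<=` J)%classic.
Proof. by move=> hI idJ IJ; rewrite hI; apply: ideal_gen_min => // f []; apply: IJ. Qed.

Lemma prod_homogeneous (T : Type) (s : seq T) (P : pred T) (F : T -> R) :
  (forall i, P i -> H (F i)) -> H (\prod_(i <- s | P i) F i).
Proof. by move=> HF; apply: big_ind. Qed.

Lemma graded_prime_prod p (T : Type) (s : seq T) (P : pred T) (F : T -> R) :
    graded_prime_ideal H p -> (forall i, P i -> H (F i) /\ ~ p (F i)) ->
  ~ p (\prod_(i <- s | P i) F i).
Proof.
case=> _ p1 pM pF.
suff []: H (\prod_(i <- s | P i) F i) /\ ~ p (\prod_(i <- s | P i) F i) by [].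
apply: (big_ind (fun x => H x /\ ~ p x)) => // x y [Hx px] [Hy py].
by split; [apply: HM|case/(pM _ _ Hx Hy)].
Qed.

Lemma ideal_prod I (T : finType) (P : pred T) (F : T -> R) i :
  ideal I -> P i -> I (F i) -> I (\prod_(j | P j) F j).
Proof. by case=> _ _ IM Pi IFi; rewrite (bigD1 i) //= mulrC; apply: IM. Qed.

(** Otherwise a product of homogeneous elements, one from each Q i and all of
    them outside p, would lie in the intersection. *)
Lemma bigcap_sub_graded_prime p (T : finType) (D : {set T}) (Q : T -> set R) :
    graded_prime_ideal H p -> (forall i, i \in D -> homogeneous_ideal H (Q i)) ->
    (\bigcap_(i in [set` D]) Q i `<=` p)%classic ->
  exists2 i, i \in D & (Q i `<=` p)%classic.
Proof.
move=> prp hQ Qp; apply: contrapT => noi.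
have F i : {f | H f /\ (i \in D -> Q i f /\ ~ p f)}.
  apply: cid.
  case: (boolP (i \in D)) => [Di|_]; last by exists 1.
  apply: contrapT => nof; apply: noi; exists i => //.
  apply: (homogeneous_ideal_sub (hQ _ Di)); first by case: prp => /homogeneous_idealP.
  move=> f Qf Hf; apply: contrapT => pf; apply: nof; by exists f.
apply: (@graded_prime_prod p _ (index_enum T) (mem D) (fun i => sval (F i)) prp).
  by move=> i Di; case: (F i) => f [Hf fP]; have [] := fP Di.
apply: Qp => i Di; apply: (@ideal_prod _ _ _ _ i) => //.
  exact/homogeneous_idealP/hQ.
by case: (F i) => f [Hf fP]; have [] := fP Di.
Qed.

(** The components Q i are pairwise incomparable primes, so none is redundant.
    Conversely, let the Q' j form any minimal decomposition of I.  Each Q i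
    contains some Q' j, and equals it by the argument commented in the proof; a
    further component would be redundant, the Q i already intersecting in I.
    Keeping the set H of homogeneous elements, the notion of primary ideal and
    the radical as parameters covers the graded and the ungraded decomposition
    at once. *)
Lemma the_minimal_decomposition_of_primes (primary : set R -> Prop)
    (rad : set R -> set R) (T : finType) (D : {set T}) (Q : T -> set R) I :
    (forall J, primary J -> graded_primary_ideal H J) ->
    (forall i, i \in D -> primary (Q i)) ->
    (forall i, i \in D -> rad (Q i) = Q i) ->
    (forall i, i \in D -> graded_prime_ideal H (Q i)) ->
    (forall i j, i \in D -> j \in D -> i != j ->
       exists f, [/\ H f, Q i f & ~ Q j f]) ->
    I = (\bigcap_(i in [set` D]) Q i)%classic ->
  the_minimal_decomposition primary rad D Q I.
Proof.
move=> primW primQ radQ prQ sepQ IE.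
have sep i j : i \in D -> j \in D -> (Q i `<=` Q j)%classic -> i = j.
  move=> Di Dj Qij; apply/eqP; apply: contrapT => /negP/(sepQ _ _ Di Dj).
  by move=> [f [_ /Qij]].
have irr i : i \in D -> ~ (\bigcap_(j in [set` D :\ i]) Q j `<=` Q i)%classic.
  move=> Di /bigcap_sub_graded_prime[||j]; first exact: prQ.
    by move=> j; rewrite !inE => /andP[_ /prQ[]].
  by rewrite !inE => /andP[ji Dj] /(sep _ _ Dj Di)/eqP; rewrite (negPf ji).
split.
  by split=> // i j Di Dj; rewrite !radQ // => Qij; apply: sep => //; rewrite Qij.
move=> k Q' [IE' primQ' _ irrQ'].
have hQ' i : homogeneous_ideal H (Q' i) by have /primW[] := primQ' i (finset.in_setT i).
have compQ i : i \in D -> exists j, Q' j = Q i.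
  move=> Di; have hi := prQ _ Di.
  have [//||j _ Q'j] := @bigcap_sub_graded_prime (Q i) _ [set: 'I_k]%SET Q' hi.
    by rewrite -IE' IE => f /(_ i); apply.
  exists j; apply/seteqP; split=> //.
  (* A homogeneous s in the other components and outside Q i multiplies Q i
     into I, hence into Q' j, while no power of s lies in Q' j: since Q' j is
     primary, it contains Q i. *)
  have [s [Hs Ds Qs]] : exists s, [/\ H s, forall l, l \in D -> l != i -> Q l s & ~ Q i s].
    have F l : {f | l \in D -> l != i -> [/\ H f, Q l f & ~ Q i f]}.
      apply: cid.
      case: (boolP ((l \in D) && (l != i))) => [/andP[Dl li]|].
        by have [f fP] := sepQ _ _ Dl Di li; exists f.
      by move=> nl; exists 0 => Dl li; rewrite Dl li in nl.
    exists (\prod_(l in D :\ i) sval (F l)); split.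
    - apply: prod_homogeneous => l; rewrite !inE => /andP[li Dl].
      by case: (F l) => f fP; have [] := fP Dl li.
    - move=> l Dl li; apply: (@ideal_prod _ _ _ _ l).
      + by apply: homogeneous_idealP; case: (prQ _ Dl).
      + by rewrite !inE li.
      + by case: (F l) => f fP; have [] := fP Dl li.
    - apply: graded_prime_prod => // l; rewrite !inE => /andP[li Dl].
      by case: (F l) => f fP; have [] := fP Dl li.
  apply: homogeneous_ideal_sub; [by case: hi|exact/homogeneous_idealP/hQ'|].
  move=> f Qf Hf; have /primW[_ _ /(_ f s Hf Hs)] := primQ' j (finset.in_setT j).
  case=> [|//|[e /Q'j Qse]].
    suff : I (f * s) by rewrite IE'; apply; rewrite /= finset.in_setT.
    rewrite IE => l Dl; case: (eqVneq l i) => [->|li].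
      by rewrite mulrC; case: (homogeneous_idealP (let: And3 h _ _ := hi in h)) => _ _; apply.
    by case: (homogeneous_idealP (let: And3 h _ _ := prQ _ Dl in h)) => _ _; apply; apply: Ds.
  case: Qs; case: hi => _ Q1 QM; elim: e Qse => [|e IHe]; first by rewrite expr0.
  rewrite exprS => /(QM _ _ Hs)[|//|//].
  by elim: e {IHe} => [|e IHe]; rewrite ?expr0 // exprS; apply: HM.
move=> J; split=> [[j <-]|[i Di <-]]; last exact: compQ.
apply: contrapT => noi; apply: (irrQ' j (finset.in_setT j)) => f Q'f.
suff : I f by rewrite IE'; apply; rewrite /= finset.in_setT.
rewrite IE => i Di; have [l Q'l] := compQ i Di; rewrite -Q'l; apply: Q'f.
rewrite /= !inE andbT; apply/eqP => lj; apply: noi; exists i => //.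
by rewrite -Q'l lj.
Qed.

End MinimalDecompositions.

(** When every element is declared homogeneous, the graded notions become the
    usual ones; this is how the ungraded statements are obtained. *)
Section AllHomogeneous.
Variable R : comNzRingType.
Local Notation allH := (classical_sets.setT : set R).

Lemma homogeneous_ideal_all (J : set R) : ideal J -> homogeneous_ideal allH J.
Proof. by move=> idJ; rewrite /homogeneous_ideal classical_sets.setIT ideal_gen_id. Qed.

Lemma graded_prime_all (p : set R) : prime_ideal p -> graded_prime_ideal allH p.
Proof.
by case=> idp p1 pM; split=> //; [apply: homogeneous_ideal_all|move=> f g _ _; apply: pM].
Qed.

Lemma graded_primary_all (J : set R) : primary_ideal J -> graded_primary_ideal allH J.
Proof.
by case=> idJ J1 JM; split=> //; [apply: homogeneous_ideal_all|move=> f g _ _; apply: JM].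
Qed.

End AllHomogeneous.

Section QuotientDimension.
Variables (R : comNzRingType) (I : set R).
Hypotheses (idI : ideal I) (I1 : ~ I 1).
Local Open Scope quotient_scope.

Lemma bundle_ideal : exists J : idealr R, forall f, f \in J <-> I f.
Proof.
pose b : pred R := fun f => `[< I f >].
have bP f : reflect (I f) (f \in b) by exact: asboolP.
have bcl : idealr_closed b.
  case: (idI) => I0 ID IM; split; first exact/bP.
    by apply/bP.
  by move=> a u v /bP Iu /bP Iv; apply/bP; apply: ID => //; apply: IM.
pose J : idealr R := HB.pack b (isIdealr.Build R b bcl).
by exists J => f; split=> /bP.
Qed.

(** Prime chains of the quotient by I correspond to prime chains starting above
    I, by taking preimages and images under the projection. *)
Lemma quotient_krull_dim (d : nat) :
    (exists c, prime_chain c d /\ (I `<=` c 0%N)%classic) ->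
    (forall c k, prime_chain c k -> (I `<=` c 0%N)%classic -> (k <= d)%N) ->
  quotient_krull_dim_is I d.
Proof.
move=> [c [[prc ltc] Ic]] ub; have [J JI] := bundle_ideal; exists J; split=> //.
have piJ f g : \pi_{ideal_quot J} f = \pi g -> I (f - g).
  by move=> fg; apply/JI; rewrite Quotient.idealrBE; apply/eqP.
split.
  have subc i : (i <= d)%N -> (I `<=` c i)%classic.
    elim: i => // i IHi id; apply: classical_sets.subset_trans (IHi (ltnW id)) _.
    by case: (ltc i id).
  have mem i f : (i <= d)%N -> c i (generic_quotient.repr (\pi_{ideal_quot J} f)) <-> c i f.
    move=> id; have [idc _ _] := prc i id.
    have If : I (generic_quotient.repr (\pi_{ideal_quot J} f) - f) by apply: piJ; rewrite reprK.
    split=> [cf|]; last by apply: idealBr => //; apply: subc If.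
    apply: (idealBr idc (g := generic_quotient.repr (\pi_{ideal_quot J} f))) => //.
    by rewrite -opprB; apply: idealN => //; apply: subc If.
  exists (fun i => [set x | c i (generic_quotient.repr x)]%classic); split=> i id.
    have [[c0 cD cM] c1 cP] := prc i id; split; first split.
    - by rewrite /= -[0]reprK -(rmorph0 (\pi_{ideal_quot J})) reprK mem.
    - move=> x y; rewrite -[x]reprK -[y]reprK /= -rmorphD !mem //; exact: cD.
    - move=> x y; rewrite -[x]reprK -[y]reprK /= -rmorphM !mem //; exact: cM.
    - by rewrite /= -(rmorph1 (\pi_{ideal_quot J})) mem.
    - move=> x y; rewrite -[x]reprK -[y]reprK /= -rmorphM !mem //; exact: cP.
  have [sub nsub] := ltc i id; split=> [x /sub //|subr]; apply: nsub => f.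
  by rewrite -mem // -(@mem i) 1?ltnW //; apply: subr.
move=> c' k [prc' ltc'].
pose C i : set R := [set f | c' i (\pi_{ideal_quot J} f)]%classic.
apply: (ub C).
  split=> i id.
    have [[c0 cD cM] c1 cP] := prc' i id; split; first split.
    - by rewrite /C /= rmorph0.
    - by move=> f g; rewrite /C /= rmorphD; apply: cD.
    - by move=> f g; rewrite /C /= rmorphM; apply: cM.
    - by rewrite /C /= rmorph1.
    - by move=> f g; rewrite /C /= rmorphM; apply: cP.
  have [sub nsub] := ltc' i id; split=> [x /sub //|subr]; apply: nsub => x.
  by rewrite -[x]reprK; apply: subr.
move=> f If; have [[c0 _ _] _ _] := prc' 0%N (leq0n _).
rewrite /C /= (_ : \pi f = 0) // -(rmorph0 (\pi_{ideal_quot J})).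
by apply/eqP; rewrite -Quotient.idealrBE subr0; apply/JI.
Qed.

End QuotientDimension.

(** * The dimension of a polynomial ring *)

Section PolynomialDimension.
Variables (K : fieldType) (r : nat).
Local Notation S := {mpoly K[r]}.

Definition independent_mod (p : set S) (T : finType) (b : T -> S) : Prop :=
  forall a : T -> K, p (\sum_t a t *: b t) -> forall t, a t = 0.

(** This is the step that makes dimension drop along a strict inclusion of
    primes: an element f of q outside p is transcendental, modulo p, over
    anything independent modulo q. *)
Lemma independent_mod_power (p q : set S) (f : S) (N : nat) (T : finType) (b : T -> S) :
    prime_ideal p -> ideal q -> (p `<=` q)%classic -> q f -> ~ p f ->
    independent_mod q b ->
  independent_mod p (fun x : 'I_N * T => f ^+ x.1 * b x.2).
Proof.
move=> [idp p1 pM] idq pq qf pf indb a.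
pose g (i : 'I_N) : S := \sum_t a (i, t) *: b t.
have -> : \sum_x a x *: (f ^+ x.1 * b x.2) = \sum_(i < N) f ^+ i * g i.
  transitivity (\sum_(i < N) \sum_t a (i, t) *: (f ^+ i * b t)).
    by rewrite pair_bigA /=; apply: eq_bigr => -[i t].
  by apply: eq_bigr => i _; rewrite mulr_sumr; apply: eq_bigr => t _; rewrite scalerAr.
move=> psum.
(* The coefficients of the powers of f vanish one after the other, lowest
   first: once f ^+ k is divided out, the sum is g k modulo f, and f is in q. *)
suff g0 k (i : 'I_N) : (i < k)%N -> forall t, a (i, t) = 0.
  by case=> i t; apply: (g0 i.+1).
elim: k i => // k IHk i; rewrite ltnS leq_eqVlt => /orP[/eqP ik|]; last exact: IHk.
apply: indb; rewrite -/(g i).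
have low (j : 'I_N) : (j < k)%N -> g j = 0.
  by move=> jk; rewrite /g big1 // => t _; rewrite IHk // scale0r.
pose h := \sum_(j < N | (k < j)%N) f ^+ (j - k.+1) * g j.
have sumE : \sum_(j < N) f ^+ j * g j = f ^+ k * (g i + f * h).
  rewrite (bigID (fun j : 'I_N => (j < k)%N)) /= big1 ?add0r; last first.
    by move=> j /low ->; rewrite mulr0.
  rewrite (bigD1 i) /=; last by rewrite ik ltnn.
  rewrite mulrDr {1}ik; congr (_ + _).
  rewrite mulrA -exprSr mulr_sumr; apply: eq_big => [j|j].
    by rewrite -leqNgt (ltn_neqAle k) andbC -ik eq_sym.
  rewrite -leqNgt => /andP[kj ji]; rewrite mulrA -exprD subnKC // ltn_neqAle kj andbT.
  by rewrite -ik eq_sym.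
have : p (g i + f * h).
  move: psum; rewrite sumE; elim: (k) => [|m IHm]; first by rewrite expr0 mul1r.
  by rewrite exprS -mulrA => /pM[].
move/pq; rewrite addrC => qg.
have qfh : q (f * h) by rewrite mulrC; case: idq => _ _; apply.
by rewrite -[g i](addKr (f * h)); case: (idq) => _ qD _; apply: qD => //; apply: idealN.
Qed.

Lemma msize_mul_le (f g : S) : (msize (f * g) <= msize f + msize g)%N.
Proof.
have [->|f0] := eqVneq f 0; first by rewrite mul0r msize0.
have [->|g0] := eqVneq g 0; first by rewrite mulr0 msize0.
by rewrite msizeM // leq_pred.
Qed.

Lemma msize_exp_le (f : S) k N : (k < N)%N -> (msize (f ^+ k) <= (msize f).+1 * N)%N.
Proof.
move=> kN; apply: (@leq_trans ((msize f).+1 * k.+1)); last by rewrite leq_mul2l.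
elim: {N kN} k => [|k IHk]; first by rewrite expr0 msize1 muln1.
rewrite exprS; apply: leq_trans (msize_mul_le _ _) _.
by rewrite mulnS; apply: leq_add => //; apply: leqnSn.
Qed.

(** A strict chain of k inclusions yields elements f_1, ..., f_k whose monomials
    with exponents below N are independent modulo the bottom prime.  There are
    N^k of them, of degree at most a constant times N, the constant depending on
    the f_i only. *)
Lemma prime_chain_independent (c : nat -> set S) (k : nat) : prime_chain c k ->
  exists D, forall N, (0 < N)%N -> exists (T : finType) (b : T -> S),
    [/\ #|T| = (N ^ k)%N, forall t, (msize (b t) <= D * N)%N
      & independent_mod (c 0%N) b].
Proof.
elim: k c => [|k IHk] c [prc ltc].
  exists 1%N => N N0; exists unit, (fun=> 1); split.
  - by rewrite card_unit expn0.
  - by move=> _; rewrite msize1 mul1n.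
  - move=> a; rewrite (bigD1 tt) //= big1 ?addr0; last by case.
    move=> c0a [] ; apply: contrapT => /eqP a0; have [[_ _ cM] c1 _] := prc 0%N isT.
    apply: c1; suff -> : 1 = (a tt)^-1%:MP * (a tt *: 1) :> S by apply: cM.
    by rewrite mul_mpolyC scalerA mulVf // scale1r.
have [D DP] : exists D, forall N, (0 < N)%N -> exists (T : finType) (b : T -> S),
    [/\ #|T| = (N ^ k)%N, forall t, (msize (b t) <= D * N)%N
      & independent_mod (c 1%N) b].
  by apply: (IHk (fun i => c i.+1)); split=> i ik; [apply: prc|apply: ltc].
have [c01 /existsNP[f /not_implyP[c1f c0f]]] := ltc 0%N isT.
exists ((msize f).+1 + D)%N => N N0; have [T [b [cT bD indb]]] := DP N N0.
exists ('I_N * T)%type, (fun x : 'I_N * T => f ^+ x.1 * b x.2); split.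
- by rewrite card_prod card_ord cT expnS.
- move=> x; apply: leq_trans (msize_mul_le _ _) _; rewrite mulnDl.
  by apply: leq_add => //; apply: msize_exp_le.
- apply: (@independent_mod_power (c 0%N) (c 1%N)) => //; first exact: prc.
  by have [] := prc 1%N isT.
Qed.

Lemma card_bounded_monomials (M : nat) : (#|{: 'X_{1..r < M}}| <= M ^ r)%N.
Proof.
case: M => [|M].
  rewrite (_ : #|_| = 0%N) //; apply: eq_card0 => -[m mM].
  by have := mM; rewrite ltn0.
have <- : #|{ffun 'I_r -> 'I_M.+1}| = (M.+1 ^ r)%N by rewrite card_ffun !card_ord.
apply: (@leq_card _ _ (fun m : 'X_{1..r < M.+1} => [ffun i => inord (m i) : 'I_M.+1])).
move=> m m' /ffunP mm'; apply: val_inj; apply/mnmP => i.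
have bd (l : 'X_{1..r < M.+1}) : (l i < M.+1)%N.
  by apply: leq_ltn_trans (bmdeg l); rewrite mdegE (bigD1 i) //= leq_addr.
by have /(congr1 (@nat_of_ord _)) := mm' i; rewrite !ffunE !inordK.
Qed.

Lemma independent_card (p : set S) (T : finType) (b : T -> S) (M : nat) :
    p 0 -> independent_mod p b -> (forall t, (msize (b t) <= M)%N) ->
  (#|T| <= M ^ r)%N.
Proof.
move=> p0 indb bM; apply: leq_trans (card_bounded_monomials M).
pose A := \matrix_(i < #|T|, j < #|{: 'X_{1..r < M}}|)
  (b (enum_val i))@_(enum_val j : 'X_{1..r < M}).
suff /eqP <- : row_free A by apply: rank_leq_col.
rewrite -kermx_eq0; apply/eqP/row_matrixP => i; rewrite row0.
set v := row i _; have vA : v *m A = 0.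
  by apply/sub_kermxP; rewrite row_sub.
apply/rowP => l; rewrite [RHS]mxE -[l]enum_valK.
apply: (indb (fun t => v 0 (enum_rank t)) _ (enum_val l)).
rewrite (_ : \sum_t _ = 0) //.
apply/mpolyP => m; rewrite mcoeff0 raddf_sum /=.
have [mM|Mm] := ltnP (mdeg m) M; last first.
  rewrite big1 // => t _; rewrite mcoeffZ (_ : (b t)@_m = 0) ?mulr0 //.
  apply/eqP; rewrite mcoeff_eq0; apply/negP => /msize_mdeg_lt.
  by rewrite ltnNge (leq_trans (bM t)).
have /rowP/(_ (enum_rank (BMultinom mM))) := vA; rewrite !mxE => vA0.
rewrite -[RHS]vA0 (reindex_onto enum_rank enum_val) /=; last by move=> j _; rewrite enum_valK.
apply: eq_big => [t|t _]; first by rewrite enum_rankK eqxx.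
by rewrite mcoeffZ !mxE !enum_rankK.
Qed.

(** Growth comparison: for k > r, the N^k independent polynomials of degree
    O(N) outgrow the O(N^r) monomials available.  With N = D^r + 1 one has
    N^(r+1) > (D N)^r. *)
Theorem prime_chain_mpoly_le (c : nat -> set S) (k : nat) :
  prime_chain c k -> (k <= r)%N.
Proof.
move=> prc; have [D DP] := prime_chain_independent prc; rewrite leqNgt; apply/negP => rk.
have [T [b [cT bD indb]]] := DP (D ^ r).+1 isT.
have [[c0 _ _] _ _] := prc.1 0%N (leq0n k).
have := independent_card c0 indb bD; rewrite cT expnMn leqNgt => /negP; apply.
apply: (@leq_trans ((D ^ r).+1 ^ r.+1)); last by rewrite leq_pexp2l.
by rewrite expnS ltn_pmul2r // expn_gt0.
Qed.

End PolynomialDimension.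

(** * Class sums and twisted lattice ideals *)

Section ExponentVectors.
Variables (K : finFieldType) (r : nat).
Implicit Types (m : 'X_{1..r}) (u v z : 'cV[int]_r) (P : torus K r).

Definition expvec m : 'cV[int]_r := \col_i (m i)%:Z.

Lemma expvecD m1 m2 : expvec (m1 + m2) = expvec m1 + expvec m2.
Proof. by apply/colP => i; rewrite !mxE mnmDE PoszD. Qed.

Lemma expvecMn m k : expvec (m *+ k) = expvec m *+ k.
Proof. by apply/colP => i; rewrite mulmxnE !mxE mulmnE PoszM mulrC -mulr_natl natz. Qed.

Lemma expvec_parts u : expvec (pos_part u) - expvec (neg_part u) = u.
Proof.
apply/colP => i; rewrite !mxE !mnmE; case: (ltrgtP (u i 0) 0) => [u0|u0|->] //.
  by rewrite ltz0_abs // sub0r opprK.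
by rewrite gtz0_abs // subr0.
Qed.

(** The binomial of a difference of exponents is thus the binomial in the two
    monomials divided by their greatest common divisor. *)
Lemma parts_expvecB m m' :
  pos_part (expvec m - expvec m') = (m - m')%MM /\
  neg_part (expvec m - expvec m') = (m' - m)%MM.
Proof.
split; apply/mnmP => i; rewrite mnmBE mnmE !mxE ?subr_ge0 ?subr_le0 lez_nat;
  case: leqP => mm'.
- by rewrite distnEl.
- by apply/esym/eqP; rewrite subn_eq0 ltnW.
- by rewrite distnEr.
- by apply/esym/eqP; rewrite subn_eq0 ltnW.
Qed.

Lemma torus_neq0 P i : (val (P i) : K) != 0.
Proof. by rewrite -unitfE; exact: (valP (P i)). Qed.

Lemma laurent_monD u v P : laurent_mon (u + v) P = laurent_mon u P * laurent_mon v P.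
Proof.
rewrite /laurent_mon -big_split; apply: eq_bigr => i _ /=.
by rewrite mxE expfzDr // torus_neq0.
Qed.

Lemma laurent_mon0 P : laurent_mon 0 P = 1.
Proof. by rewrite /laurent_mon big1 // => i _; rewrite mxE expr0z. Qed.

Lemma laurent_mon_neq0 u P : laurent_mon u P != 0.
Proof. by apply/prodf_neq0 => i _; rewrite expfz_neq0 // torus_neq0. Qed.

Lemma laurent_monMn u k P : laurent_mon (u *+ k) P = laurent_mon u P ^+ k.
Proof.
elim: k => [|k IHk]; first by rewrite mulr0n laurent_mon0.
by rewrite mulrS laurent_monD IHk exprS.
Qed.

Lemma meval_expvec m P : ('X_[m] : {mpoly K[r]}).@[fun i => val (P i)] = laurent_mon (expvec m) P.
Proof. by rewrite mevalX; apply: eq_bigr => i _; rewrite mxE. Qed.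

End ExponentVectors.

Section ClassSums.
Variables (K : finFieldType) (r : nat).
Local Notation S := {mpoly K[r]}.
Implicit Types (L : {pred 'cV[int]_r}) (P Q : torus K r) (z u : 'cV[int]_r).
Implicit Types (f g : S) (m : 'X_{1..r}).

Definition class_part L z f : S :=
  \sum_(m <- msupp f | expvec m - z \in L) f@_m *: 'X_[m].

(** The coefficient of the class of z in the image of f in the group algebra of
    Z^r / L, under the map sending a monomial to its value at P times its
    class. *)
Definition class_sum L P z f : K :=
  \sum_(m <- msupp f | expvec m - z \in L) f@_m * laurent_mon (expvec m) P.

(** Linearity is only visible once the support of f is replaced by a range of
    exponents that does not depend on f. *)
Lemma class_sumE L P z f k : (msize f <= k)%N ->
  class_sum L P z f = \sum_(m : 'X_{1..r < k} | expvec m - z \in L)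
                          f@_m * laurent_mon (expvec m) P.
Proof.
move=> fk; rewrite /class_sum big_mkcond [RHS]big_mkcond.
rewrite (ssrcomplements.big_mksub ('X_{1..r < k} : subFinType _)) ?msupp_uniq //=; last first.
  by move=> m /msize_mdeg_lt /leq_trans; apply.
rewrite big_rmcond //= => m /memN_msupp_eq0 ->.
by rewrite mul0r if_same.
Qed.

Lemma class_sum_is_scalar L P z : scalar (class_sum L P z).
Proof.
move=> a f g; pose k := maxn (msize (a *: f + g)) (maxn (msize f) (msize g)).
rewrite !(@class_sumE L P z _ k) ?leq_max ?leqnn ?orbT //.
rewrite mulr_sumr -big_split /=; apply: eq_bigr => m _.
by rewrite mcoeffD mcoeffZ mulrDl mulrA.
Qed.

HB.instance Definition _ L P z :=
  GRing.isLinear.Build K S K *%R (class_sum L P z) (class_sum_is_scalar L P z).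

Lemma class_sumX L P z m :
  class_sum L P z 'X_[m] = if expvec m - z \in L then laurent_mon (expvec m) P else 0.
Proof. by rewrite /class_sum msuppX big_mkcond big_seq1 mcoeffX eqxx mul1r. Qed.

Lemma class_sumMX L P z f m :
  class_sum L P z (f * 'X_[m]) = laurent_mon (expvec m) P * class_sum L P (z - expvec m) f.
Proof.
rewrite {1}[f]mpolyE mulr_suml linear_sum /= [X in _ = _ * X]/class_sum mulr_sumr [RHS]big_mkcond.
apply: eq_bigr => m' _; rewrite -scalerAl -mpolyXD linearZ_LR /= class_sumX.
rewrite expvecD opprB addrA; case: ifP => _; last by rewrite mulr0.
by rewrite laurent_monD mulrCA mulrC mulrAC mulrC.
Qed.

Lemma meval_class_part L P z f :
  (class_part L z f).@[fun i => val (P i)] = class_sum L P z f.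
Proof.
rewrite /class_part raddf_sum; apply: eq_bigr => m _.
by rewrite /= mevalZ meval_expvec.
Qed.

Lemma class_sum_supp L P z f : class_sum L P z f != 0 ->
  exists2 m, m \in msupp f & expvec m - z \in L.
Proof.
apply: contraNP => nom; apply/eqP; rewrite /class_sum big_seq_cond big1 // => m /andP[fm Lm].
by case: nom; exists m.
Qed.

Lemma class_sum_ideal L P : ideal (fun f => forall z, class_sum L P z f = 0).
Proof.
split=> [z|f g f0 g0 z|h f f0 z]; first exact: linear0.
  by rewrite linearD /= f0 g0 addr0.
rewrite [h]mpolyE mulr_suml linear_sum big1 // => m _ /=.
by rewrite mulrC -scalerAr linearZ_LR /= class_sumMX f0 !mulr0.
Qed.

Section Lattice.
Variables (L : {pred 'cV[int]_r}) (HL : zmod_closed L).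

Let L0 : 0 \in L. Proof. by case: HL. Qed.
Let LB u v : u \in L -> v \in L -> u - v \in L. Proof. by case: HL => _; apply. Qed.
Let LN u : u \in L -> - u \in L. Proof. by move=> Lu; rewrite -sub0r; apply: LB. Qed.
Lemma latticeD u v : u \in L -> v \in L -> u + v \in L.
Proof. by move=> Lu Lv; rewrite -[v]opprK; apply/LB/LN. Qed.

Lemma lattice_trans u v w : u - v \in L -> v - w \in L -> u - w \in L.
Proof. by move=> uv vw; rewrite -(subrK v u) -addrA; apply: latticeD. Qed.

Lemma lattice_sym u v : (u - v \in L) = (v - u \in L).
Proof. by apply/idP/idP => /LN; rewrite opprB. Qed.

Lemma lattice_congr u v w : u - v \in L -> (w - u \in L) = (w - v \in L).
Proof.
move=> uv; apply/idP/idP => [wu|wv]; first exact: lattice_trans wu uv.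
by apply: lattice_trans wv _; rewrite lattice_sym.
Qed.

Lemma class_sum_congr P z z' f : z - z' \in L -> class_sum L P z f = class_sum L P z' f.
Proof. by move=> zz'; apply: eq_bigl => m; apply: lattice_congr. Qed.

(** A polynomial is the sum of its class parts; rep picks in each class the same
    exponent for all of its members, so that the sum can be grouped by it. *)
Lemma ideal_class_part (J : set S) f :
  ideal J -> (forall z, J (class_part L z f)) -> J f.
Proof.
move=> idJ Jf; pose k := msize f; pose T : finType := 'X_{1..r < k}.
pose rep (m : T) : T := odflt m [pick m' : T | expvec m' - expvec m \in L].
have repP (m : T) : expvec (rep m) - expvec m \in L.
  by rewrite /rep; case: pickP => //= _; rewrite subrr.
have rep_eq (m m' : T) : expvec m - expvec m' \in L -> rep m = rep m'.
  move=> mm'; rewrite /rep (@eq_pick _ _ (fun m1 : T => expvec m1 - expvec m' \in L)).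
    by case: pickP => //= /(_ m'); rewrite subrr L0.
  by move=> m1; apply: lattice_congr.
rewrite (mpolywE (leqnn (msize f))) (partition_big rep xpredT) //=.
apply: ideal_sum => // m' _; case: (pickP (fun m : T => rep m == m'))
  => [m1 /eqP m1m'|no]; last first.
  by rewrite big_pred0 //; case: idJ.
suff -> : \sum_(m : T | rep m == m') f@_m *: 'X_[m] = class_part L (expvec m') f by [].
rewrite /class_part big_mkcond [RHS]big_mkcond.
rewrite (ssrcomplements.big_mksub ('X_{1..r < k} : subFinType _)) ?msupp_uniq //=; last first.
  by move=> m /msize_mdeg_lt /leq_trans; apply.
rewrite [RHS]big_rmcond //= => [|m /memN_msupp_eq0 ->]; last by rewrite scale0r if_same.
apply: eq_bigr => m _; congr (if _ then _ else _); apply/eqP/idP => [<-|mm'].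
  by rewrite lattice_sym; apply: repP.
rewrite -m1m'; apply: rep_eq; apply: lattice_trans mm' _.
by rewrite -m1m'; apply: repP.
Qed.

Lemma class_sum_binomial P u z : u \in L ->
  class_sum L P z ('X_[pos_part u] - laurent_mon u P *: 'X_[neg_part u]) = 0.
Proof.
move=> Lu; rewrite linearB linearZ_LR /= !class_sumX.
rewrite -(lattice_sym z) -(lattice_sym z) (@lattice_congr _ (expvec (neg_part u))).
  case: ifP => _; last by rewrite mulr0 subr0.
  by rewrite -laurent_monD -{2}(expvec_parts u) subrK subrr.
by rewrite expvec_parts.
Qed.

Lemma twisted_binomial P m m' : expvec m - expvec m' \in L ->
  twisted_lattice_ideal L P
    ('X_[m] - laurent_mon (expvec m - expvec m') P *: 'X_[m']).
Proof.
move=> Lmm'; have [pE nE] := parts_expvecB m m'.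
have [_ _ tM] := ideal_gen_ideal (fun f => exists2 m, m \in L &
    f = 'X_[pos_part m] - laurent_mon m P *: 'X_[neg_part m]).
pose g := [multinom minn (m i) (m' i) | i < r].
have -> : 'X_[m] - laurent_mon (expvec m - expvec m') P *: 'X_[m'] =
   'X_[g] * ('X_[m - m'] - laurent_mon (expvec m - expvec m') P *: 'X_[m' - m]) :> S.
  rewrite mulrBr -scalerAr -!mpolyXD.
  congr ('X_[_] - _ *: 'X_[_]); apply/mnmP => i; rewrite mnmDE mnmBE mnmE.
    by rewrite minnE subnK // leq_subr.
  by rewrite minnC minnE subnK // leq_subr.
apply: tM; apply: mem_ideal_gen; exists (expvec m - expvec m') => //.
by rewrite pE nE.
Qed.

(** The kernel of the map to the group algebra is generated by the binomials:
    modulo these, the monomials of a class part are multiples of a single one,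
    and the coefficient that results is a unit times the class sum. *)
Lemma twisted_lattice_idealE P :
  twisted_lattice_ideal L P = (fun f => forall z, class_sum L P z f = 0) :> set S.
Proof.
apply/seteqP; split=> [|f f0].
  apply: ideal_gen_min; first exact: class_sum_ideal.
  by move=> _ [u Lu ->] z; apply: class_sum_binomial.
have idt : ideal (twisted_lattice_ideal L P) by apply: ideal_gen_ideal.
apply: ideal_class_part => // z.
rewrite /class_part; case: (pickP (fun i : 'I_(size (msupp f)) =>
   expvec (nth 0%MM (msupp f) i) - z \in L)) => [i0 z0|no]; last first.
  rewrite big_seq_cond big1 => [|m /andP[/(nthP 0%MM)[i isz <-]]]; first by case: idt.
  by have := no (Ordinal isz) => /= ->.
set m0 := nth _ _ _ in z0.
suff -> : \sum_(m <- msupp f | expvec m - z \in L) f@_m *: 'X_[m] =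
  \sum_(m <- msupp f | expvec m - z \in L)
    f@_m *: ('X_[m] - laurent_mon (expvec m - expvec m0) P *: 'X_[m0]) :> S.
  apply: ideal_sum => // m mz; rewrite -mul_mpolyC; case: (idt) => _ _; apply.
  by apply: twisted_binomial; rewrite (lattice_congr _ z0).
under [RHS]eq_bigr do rewrite scalerBr scalerA.
rewrite sumrB -scaler_suml [X in _ - X *: _](_ : _ = 0) ?scale0r ?subr0 //.
under eq_bigr do rewrite laurent_monD mulrA.
by rewrite -mulr_suml -/(class_sum L P z f) f0 mul0r.
Qed.

(** Multiplication by the binomial of u compares the class sums of f with their
    translates by u.  If they agree, one nonzero class sum yields nonzero ones in
    the infinitely many classes of z + k u, and f has only finitely many
    exponents. *)
Lemma binomial_regular P u f :
    (forall k : nat, (0 < k)%N -> u *+ k \notin L) ->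
    twisted_lattice_ideal L P (f * ('X_[pos_part u] - laurent_mon u P *: 'X_[neg_part u])) ->
  twisted_lattice_ideal L P f.
Proof.
move=> Lu; rewrite twisted_lattice_idealE => fu z.
have shift z' : class_sum L P z' f = class_sum L P (z' + u) f.
  have := fu (z' + expvec (pos_part u)).
  rewrite mulrBr -scalerAr linearB linearZ_LR /= !class_sumMX addrK mulrA -laurent_monD.
  have -> : u + expvec (neg_part u) = expvec (pos_part u).
    by rewrite -{1}(expvec_parts u) subrK.
  rewrite -mulrBr -addrA expvec_parts => /eqP.
  by rewrite mulf_eq0 (negPf (laurent_mon_neq0 _ _)) subr_eq0 => /eqP.
have shiftn k : class_sum L P z f = class_sum L P (z + u *+ k) f.
  elim: k => [|k ->]; first by rewrite mulr0n addr0.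
  by rewrite shift mulrSr addrA.
apply/eqP; apply: contraT => fz0.
have ex k : exists i : 'I_(size (msupp f)),
    expvec (nth 0%MM (msupp f) i) - (z + u *+ k) \in L.
  have [|m /(nthP 0%MM)[i isz <-] Lm] := @class_sum_supp L P (z + u *+ k) f.
    by rewrite -shiftn.
  by exists (Ordinal isz).
pose F (k : 'I_(size (msupp f)).+1) := sval (cid (ex k)).
have /injectivePn[k [l kl Fkl]] : ~~ injectiveb F.
  by apply/negP => /injectiveP/leq_card; rewrite !card_ord ltnn.
wlog {kl} kl : k l Fkl / (k < l)%N.
  move: kl; rewrite neq_ltn => /orP[kl|lk] H; first exact: (H k l).
  exact: (H l k).
have := svalP (cid (ex k)); have := svalP (cid (ex l)); rewrite -/(F k) -/(F l) -Fkl.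
rewrite lattice_sym => /lattice_trans H /H.
rewrite opprD addrACA subrr add0r -mulrnBr ?(ltnW kl) //.
by apply: contraLR => _; apply: Lu; rewrite subn_gt0.
Qed.

End Lattice.
End ClassSums.

(** * Vanishing ideals of sets of points *)

Section ClassSumOperations.
Variables (K : finFieldType) (r : nat).
Local Notation S := {mpoly K[r]}.
Implicit Types (L : {pred 'cV[int]_r}) (P Q : torus K r) (z u : 'cV[int]_r).

Lemma meval_laurent (f : S) Q :
  f.@[fun i => val (Q i)] = \sum_(m <- msupp f) f@_m * laurent_mon (expvec m) Q.
Proof.
rewrite {1}[f]mpolyE raddf_sum; apply: eq_bigr => m _.
by rewrite /= mevalZ meval_expvec.
Qed.

(** Substituting P_i x_i for x_i. *)
Definition rescale P (f : S) : S :=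
  \sum_(m <- msupp f) (f@_m * laurent_mon (expvec m) P) *: 'X_[m].

Lemma class_sum_rescale L P Q z f :
  class_sum L Q z (rescale P f) = class_sum L (P * Q)%g z f.
Proof.
rewrite linear_sum /= [RHS]/class_sum [RHS]big_mkcond; apply: eq_bigr => m _.
rewrite linearZ_LR /= class_sumX laurent_monM; case: ifP => _; last by rewrite mulr0.
by rewrite mulrA.
Qed.

(** Raising to the power p is additive in characteristic p, and multiplication
    by p, which it induces on classes, is injective on Z^r / L: so the terms of
    f^p in the class of p z come exactly from those of f in the class of z. *)
Lemma class_sum_Frobenius L (HL : zmod_closed L) (p : nat) :
    p \in [pchar K] -> (forall u, u *+ p \in L -> u \in L) ->
  forall Q z (f : S), class_sum L Q (z *+ p) (f ^+ p) = class_sum L Q z f ^+ p.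
Proof.
move=> pK Lp Q z f.
have pS : p \in [pchar S] by rewrite pchar_lalg.
have Lpn u : u \in L -> u *+ p \in L.
  move=> Lu; elim: (p) => [|k IHk]; first by rewrite mulr0n; case: HL.
  by rewrite mulrS; apply: latticeD.
rewrite {1}[f]mpolyE -(pFrobenius_autE pS) raddf_sum linear_sum /=.
rewrite -(pFrobenius_autE pK) raddf_sum /= [RHS]big_mkcond; apply: eq_bigr => m _.
rewrite !pFrobenius_autE exprZn mpolyXn linearZ_LR /= class_sumX expvecMn -mulrnBl.
have -> : ((expvec m - z) *+ p \in L) = (expvec m - z \in L).
  by apply/idP/idP => [/Lp|/Lpn].
by case: ifP => _; rewrite ?mulr0 // laurent_monMn exprMn.
Qed.

(** Reducedness of the group algebra of a group with no p-torsion.  A power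
    f^k in the ideal may be replaced by f^(p^k), from which p-th roots are
    extracted class by class. *)
Lemma twisted_radical L (HL : zmod_closed L) (p : nat) P (f : S) k :
    p \in [pchar K] -> (forall u, u *+ p \in L -> u \in L) ->
    twisted_lattice_ideal L P (f ^+ k) ->
  twisted_lattice_ideal L P f.
Proof.
move=> pK Lp; rewrite twisted_lattice_idealE // => fk.
have idL := class_sum_ideal L P.
have fpk z : class_sum L P z (f ^+ (p ^ k)%N) = 0.
  have kpk : (k <= p ^ k)%N.
    by apply: ltnW; apply: ltn_expl; apply: prime_gt1; case/andP: pK.
  by case: idL => _ _ idM; rewrite -(subnK kpk) exprD; apply: idM.
elim: {fk} k fpk => [|k IHk] fpk; first by move=> z; rewrite -[f]expr1 -[1%N](expn0 p).
apply: IHk => z; have := fpk (z *+ p).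
rewrite expnSr exprM class_sum_Frobenius // => /eqP.
by rewrite expf_eq0 => /andP[_ /eqP].
Qed.

End ClassSumOperations.

Section VanishingIdeals.
Variables (K : finFieldType) (n r : nat) (phi : 'M[int]_(r, n)).
Variables (A : zmodType) (beta : {additive 'cV[int]_r -> A}).
Hypothesis hseq : class_group_sequence phi beta.
Local Notation S := {mpoly K[r]}.
Local Notation L := (Lbeta beta).
Implicit Types (P Q : torus K r) (z u : 'cV[int]_r).
Implicit Types (C D : TX K phi) (Y : {set TX K phi}).

Lemma Lbeta_closed : zmod_closed L.
Proof.
split; first by rewrite inE raddf0.
by move=> u v; rewrite !inE raddfB => /eqP -> /eqP ->; rewrite subr0.
Qed.

Lemma LbetaP u : reflect (exists c, u = phi *m c) (u \in L).
Proof. by case: hseq => _ Lphi _; rewrite inE; apply: (iffP eqP) => /Lphi. Qed.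

Lemma degree_expvec (m : 'X_{1..r}) :
  \sum_(j < r) beta (delta_mx j 0) *+ m j = beta (expvec m).
Proof.
have -> : expvec m = \sum_(j < r) (delta_mx j 0) *+ m j.
  apply/colP => i; rewrite mxE summxE (bigD1 i) //= big1 => [|j ji].
    by rewrite -scaler_nat !mxE !eqxx mulr1 addr0 natz.
  by rewrite -scaler_nat !mxE eq_sym (negPf ji) mulr0.
by rewrite raddf_sum; apply: eq_bigr => j _; rewrite raddfMn.
Qed.

Lemma homogeneousP (f : S) : homogeneous K beta f <->
  (exists a, forall m, m \in msupp f -> beta (expvec m) = a).
Proof. by split=> -[a fa]; exists a => m /fa; rewrite degree_expvec. Qed.

Lemma homogeneous1 : homogeneous K beta 1.
Proof.
apply/homogeneousP; exists (beta (expvec 0%MM)) => m.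
by rewrite msupp1 inE => /eqP ->.
Qed.

Lemma homogeneousM (f g : S) :
  homogeneous K beta f -> homogeneous K beta g -> homogeneous K beta (f * g).
Proof.
move=> /homogeneousP[a fa] /homogeneousP[b gb]; apply/homogeneousP; exists (a + b) => m.
move=> /msuppM_le/allpairsP[[m1 m2] /= [/fa <- /gb <- ->]].
by rewrite expvecD raddfD.
Qed.

Lemma homogeneous_class_part z (f : S) : homogeneous K beta (class_part L z f).
Proof.
apply/homogeneousP; exists (beta z) => m; rewrite mcoeff_msupp /class_part raddf_sum /=.
move=> fm; have [m' Lm' mm'] : exists2 m', expvec m' - z \in L & m' = m.
  apply: contrapT => nom; case/eqP: fm; rewrite big1 // => m' Lm'.
  rewrite mcoeffZ mcoeffX; case: eqP => [mm'|_]; last by rewrite mulr0.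
  by case: nom; exists m'.
by move: Lm'; rewrite mm' inE raddfB subr_eq0 => /eqP.
Qed.

(** A homogeneous polynomial lies in one class, whose sum is its value at Q. *)
Lemma class_sum_homogeneous Q (f : S) : homogeneous K beta f ->
  (forall z, class_sum L Q z f = 0) <-> f.@[fun i => val (Q i)] = 0.
Proof.
move=> /homogeneousP[a fa]; rewrite meval_laurent.
have all_in z m : m \in msupp f -> (expvec m - z \in L) = (a == beta z).
  by move=> /fa <-; rewrite inE raddfB subr_eq0.
split=> [f0|f0 z].
  case: (msupp f =P [::]) => [->|]; first by rewrite big_nil.
  case E: (msupp f) => [//|m0 s] _.
  rewrite -E -[RHS](f0 (expvec m0)) /class_sum big_seq [RHS]big_seq_cond.
  apply: eq_bigl => m; case fm: (m \in msupp f) => //=.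
  by rewrite all_in // fa ?eqxx // E mem_head.
rewrite /class_sum big_seq_cond; case: (eqVneq a (beta z)) => [az|az].
  rewrite -[RHS]f0 [RHS]big_seq; apply: eq_bigl => m; case fm: (m \in msupp f) => //=.
  by rewrite all_in // az eqxx.
by rewrite big1 // => m /andP[/all_in -> ]; rewrite (negPf az).
Qed.

Lemma laurent_monZ (c : int) u P : laurent_mon (c *: u) P = laurent_mon u P ^ c.
Proof.
rewrite /laurent_mon (big_morph (fun x : K => x ^ c) (fun x y => expfzMl x y c) (exp1rz _ _)).
by apply: eq_bigr => i _; rewrite mxE mulrC exprz_exp.
Qed.

Lemma laurent_mon_pi (c : 'cV[int]_n) P :
  laurent_mon (phi *m c) P = \prod_j (torus_pi phi P) 0 j ^ c j 0.
Proof.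
have -> : phi *m c = \sum_j c j 0 *: col j phi.
  apply/colP => i; rewrite mxE summxE; apply: eq_bigr => j _.
  by rewrite !mxE mulrC.
rewrite (big_morph (fun u => laurent_mon u P) (fun u v => laurent_monD u v P) (laurent_mon0 P)).
by apply: eq_bigr => j _; rewrite laurent_monZ mxE.
Qed.

Lemma mem_pt Q C : (Q \in C) = (pt phi Q == C).
Proof.
apply/idP/eqP => [/coset_mem //|<-]; by rewrite ptE rcoset_refl.
Qed.

Lemma pt_surj C : exists Q, pt phi Q = C.
Proof. by exists (repr C); apply/eqP; rewrite -mem_pt mem_repr_coset. Qed.

Lemma torus_normal Q : Q \in 'N(Ggrp K phi)%g.
Proof.
rewrite inE; apply/fintype.subsetP => Q' /imsetP[P' GP' ->].
by rewrite conjgE torus_mulC mulgK.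
Qed.

Lemma ptM P Q : pt phi (P * Q)%g = (pt phi P * pt phi Q)%g.
Proof. by rewrite /pt coset_morphM ?torus_normal. Qed.

Lemma torus_piM P Q j :
  torus_pi phi (P * Q)%g 0 j = torus_pi phi P 0 j * torus_pi phi Q 0 j.
Proof. by rewrite !mxE laurent_monM. Qed.

Lemma pt_eq P Q : (pt phi P == pt phi Q) = (torus_pi phi P == torus_pi phi Q).
Proof.
apply/eqP/eqP => [|PQ].
  move=> /(rcoset_kercosetP (torus_normal P) (torus_normal Q))/rcosetP[g + ->].
  rewrite inE => /eqP/rowP g1; apply/rowP => j.
  by rewrite torus_piM g1 mxE mul1r.
apply/(rcoset_kercosetP (torus_normal P) (torus_normal Q))/rcosetP.
exists (P * Q^-1)%g; last by rewrite mulgKV.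
have nz j : torus_pi phi Q 0 j != 0 by rewrite mxE laurent_mon_neq0.
rewrite inE; apply/eqP/rowP => j; rewrite [RHS]mxE; apply: (mulIf (nz j)).
by rewrite -torus_piM mulgKV PQ mul1r.
Qed.

Lemma laurent_mon_pt u P Q : u \in L -> pt phi P = pt phi Q ->
  laurent_mon u P = laurent_mon u Q.
Proof.
by move=> /LbetaP[c ->] /eqP; rewrite pt_eq !laurent_mon_pi => /eqP ->.
Qed.

(** Up to the factor Q^z, the class sum at z involves only the values at Q of
    elements of the lattice, and these depend on the orbit of Q alone. *)
Lemma class_sum_pt P Q z (f : S) : pt phi P = pt phi Q ->
  class_sum L P z f = 0 -> class_sum L Q z f = 0.
Proof.
move=> PQ.
have normal (P' : torus K r) : class_sum L P' z f =
    laurent_mon z P' * \sum_(m <- msupp f | expvec m - z \in L)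
                          f@_m * laurent_mon (expvec m - z) P'.
  rewrite mulr_sumr; apply: eq_bigr => m _.
  by rewrite mulrCA -laurent_monD addrC subrK.
rewrite !normal => /eqP; rewrite mulf_eq0 (negPf (laurent_mon_neq0 _ _)) /= => /eqP s0.
rewrite (_ : \sum_(m <- _ | _) _ = 0) ?mulr0 // -[RHS]s0; apply: eq_bigr => m Lm.
by rewrite (laurent_mon_pt Lm PQ).
Qed.

(** The class parts of f are its homogeneous components, and their values are
    the class sums of f. *)
Lemma vanishing_idealE Y : vanishing_ideal beta Y =
  (fun f => forall Q, pt phi Q \in Y -> forall z, class_sum L Q z f = 0).
Proof.
apply/seteqP; split=> [|f f0].
  apply: ideal_gen_min.
    split=> [Q YQ z|f g f0 g0 Q YQ|h f f0 Q YQ]; first exact: linear0.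
      by have [_ D _] := class_sum_ideal L Q; apply: D; [apply: f0|apply: g0].
    by have [_ _ M] := class_sum_ideal L Q; apply: M; apply: f0.
  move=> f [hf f0] Q YQ; apply/class_sum_homogeneous => //.
  by apply: (f0 _ YQ); rewrite mem_pt.
apply: (ideal_class_part Lbeta_closed); first exact: ideal_gen_ideal.
move=> z; apply: mem_ideal_gen; split; first exact: homogeneous_class_part.
move=> C YC Q QC; rewrite meval_class_part; apply: f0.
by move: QC; rewrite mem_pt => /eqP ->.
Qed.

Lemma vanishing_ideal_pointE P :
  vanishing_ideal beta [set pt phi P]%SET = (fun f => forall z, class_sum L P z f = 0).
Proof.
rewrite vanishing_idealE; apply/seteqP; split=> [f f0|f f0 Q].
  by apply: f0; rewrite inE.
by rewrite inE => /eqP QP z; apply: (class_sum_pt (esym QP)); apply: f0.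
Qed.

Lemma vanishing_ideal_twisted P :
  vanishing_ideal beta [set pt phi P]%SET = twisted_lattice_ideal L P.
Proof. by rewrite vanishing_ideal_pointE twisted_lattice_idealE //; apply: Lbeta_closed. Qed.

Lemma vanishing_ideal_bigcap Y : vanishing_ideal beta Y =
  (\bigcap_(C in [set` Y]) vanishing_ideal beta [set C]%SET)%classic.
Proof.
apply/seteqP; split=> [f + C /= YC|f f0].
  have [Q QC] := pt_surj C; rewrite -QC vanishing_ideal_pointE vanishing_idealE; apply.
  by rewrite QC.
rewrite vanishing_idealE => Q YQ; have := f0 _ YQ.
by rewrite vanishing_ideal_pointE.
Qed.

(** Substituting P_i x_i for x_i turns the class sums at Q into those at P Q,
    for the lattice of the grading as well as for L'; so it carries both ideals
    at P back to the given equality. *)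
Lemma vanishing_ideal_translate P (L' : zmodClosed 'cV[int]_r) Y :
    vanishing_ideal beta Y = lattice_ideal L' ->
  vanishing_ideal beta (translate (pt phi P) Y) = twisted_lattice_ideal L' P.
Proof.
have HL' : zmod_closed L' by split; [apply: rpred0|apply: rpredB].
have -> : lattice_ideal L' = twisted_lattice_ideal L' (1%g : torus K r).
  rewrite /lattice_ideal /twisted_lattice_ideal; congr ideal_gen; apply/seteqP.
  by split=> f [m Lm ->]; exists m => //; rewrite laurent_mon1 scale1r.
rewrite !twisted_lattice_idealE // !vanishing_idealE => YL.
have mem f := congr1 (fun I : set S => I (rescale P f)) YL.
apply/seteqP; split=> f f0.
  move=> z; have: forall Q, pt phi Q \in Y -> forall z, class_sum L Q z (rescale P f) = 0.
    move=> Q YQ z'; rewrite class_sum_rescale; apply: f0; rewrite ptM.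
    by apply: imset_f.
  by rewrite mem => /(_ z); rewrite class_sum_rescale mulg1.
have : forall Q, pt phi Q \in Y -> forall z, class_sum L Q z (rescale P f) = 0.
  by rewrite mem => z; rewrite class_sum_rescale mulg1.
move=> f1 Q /imsetP[D YD QD] z; have [Q' QE] := pt_surj D.
apply: (@class_sum_pt (P * Q')%g); first by rewrite ptM QE -QD.
by rewrite -class_sum_rescale; apply: f1; rewrite QE.
Qed.

Lemma homogeneous_ideal_vanishing Y :
  homogeneous_ideal (homogeneous K beta) (vanishing_ideal beta Y).
Proof.
apply/seteqP; split.
  apply: ideal_gen_min; first exact: ideal_gen_ideal.
  by move=> f fY; apply: mem_ideal_gen; split; [apply: mem_ideal_gen|case: fY].
by apply: ideal_gen_min => [|f []//]; apply: ideal_gen_ideal.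
Qed.

Lemma graded_prime_point P :
  graded_prime_ideal (homogeneous K beta) (vanishing_ideal beta [set pt phi P]%SET).
Proof.
split; first exact: homogeneous_ideal_vanishing.
  rewrite vanishing_ideal_pointE => /(class_sum_homogeneous P homogeneous1).
  by rewrite meval1 => /eqP; rewrite oner_eq0.
move=> f g hf hg; rewrite vanishing_ideal_pointE.
move=> /(class_sum_homogeneous P (homogeneousM hf hg)); rewrite mevalM => /eqP.
by rewrite mulf_eq0 => /orP[]/eqP; [left|right]; apply/class_sum_homogeneous.
Qed.

(** Two orbits differ in some coordinate of the torus T_X, that is in the value
    of the Laurent monomial of a column of phi; the binomial of that column,
    normalised to vanish on the first orbit, does not vanish on the second. *)
Lemma separate_points C D : C != D ->
  exists f, [/\ homogeneous K beta f, vanishing_ideal beta [set C]%SET f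
              & ~ vanishing_ideal beta [set D]%SET f].
Proof.
have [P <-] := pt_surj C; have [Q <-] := pt_surj D; rewrite pt_eq.
case: (pickP (fun j => torus_pi phi P 0 j != torus_pi phi Q 0 j)) => [j PQ _|eqPQ]; last first.
  by case/eqP; apply/rowP => j; apply/eqP; have /negbFE := eqPQ j.
set u := col j phi.
have Lu : u \in L by apply/LbetaP; exists (delta_mx j 0); rewrite -colE.
pose f : S := 'X_[pos_part u] - laurent_mon u P *: 'X_[neg_part u].
have hf : homogeneous K beta f.
  apply/homogeneousP; exists (beta (expvec (pos_part u))) => m /msuppB_le.
  rewrite mem_cat msuppX inE => /orP[/eqP -> //|/msuppZ_le]; rewrite msuppX inE => /eqP ->.
  by apply/esym/eqP; rewrite -subr_eq0 -raddfB expvec_parts; rewrite inE in Lu.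
exists f; split=> //.
  by rewrite vanishing_ideal_pointE => z; apply: (class_sum_binomial Lbeta_closed).
rewrite vanishing_ideal_pointE => /(class_sum_homogeneous Q hf).
rewrite mevalB mevalZ !meval_expvec => /eqP; rewrite subr_eq0.
have -> : expvec (pos_part u) = u + expvec (neg_part u).
  by rewrite -{2}(expvec_parts u) subrK.
rewrite laurent_monD (inj_eq (mulIf (laurent_mon_neq0 _ _))) => /eqP uQP.
by case/eqP: PQ; rewrite !mxE.
Qed.

End VanishingIdeals.

(** * Torsion elements and independent integer vectors *)

Section Torsion.
Variable A : zmodType.

(** Lagrange for the torsion elements: translation by a permutes them, so their
    sum equals itself plus N a. *)
Lemma torsion_order_kill (N : nat) (a : A) :
  torsion_order_is A N -> torsion_elt a -> a *+ N = 0.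
Proof.
move=> [s [us sP <-]] [k k0 ak].
have sD x : x \in s -> x + a \in s.
  move=> /sP[l l0 xl]; apply/sP; exists (l * k)%N; first by rewrite muln_gt0 l0.
  by rewrite mulrnDl mulrnA xl mul0rn add0r mulnC mulrnA ak mul0rn.
have perm : perm_eq (map (+%R^~ a) s) s.
  have um : uniq (map (+%R^~ a) s) by rewrite (map_inj_uniq (addIr a)).
  apply: uniq_perm => //.
  have sub : {subset map (+%R^~ a) s <= s} by move=> _ /mapP[x /sD sx ->].
  by apply: (uniq_min_size um sub _).2; rewrite size_map.
have : \sum_(x <- map (+%R^~ a) s) x = \sum_(x <- s) x by apply: perm_big.
rewrite big_map big_split /= -[RHS]addr0 => /addrI.
by rewrite big_const_seq count_predT -Monoid.iteropE.
Qed.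

Lemma torsion_coprime (N p : nat) (a : A) : torsion_order_is A N -> (0 < p)%N ->
  coprime N p -> a *+ p = 0 -> a = 0.
Proof.
move=> AN p0; rewrite coprime_sym => /(coprimeP _ p0)[[u v] /= uv] ap.
have aN : a *+ N = 0 by apply: torsion_order_kill => //; exists p.
rewrite -[a]mulr1n -uv mulrnBr; last by apply: ltnW; rewrite -subn_gt0 uv.
by rewrite mulnC mulrnA ap mul0rn mulnC mulrnA aN mul0rn subr0.
Qed.

End Torsion.

Section IndependentVectors.
Variable r : nat.
Implicit Types (v : nat -> 'cV[int]_r) (c : nat -> int).

Definition independent v (k : nat) : Prop :=
  forall c, \sum_(i < k) c i *: v i = 0 -> forall i, (i < k)%N -> c i = 0.

Definition int_span v (k : nat) : {pred 'cV[int]_r} :=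
  [pred u | `[< exists c, u = \sum_(i < k) c i *: v i >]].

Lemma int_spanP v k u : reflect (exists c, u = \sum_(i < k) c i *: v i) (u \in int_span v k).
Proof. by rewrite inE; apply: asboolP. Qed.

Lemma int_span_closed v k : zmod_closed (int_span v k).
Proof.
split; first by apply/int_spanP; exists (fun=> 0); rewrite big1 // => i _; rewrite scale0r.
move=> _ _ /int_spanP[c ->] /int_spanP[d ->]; apply/int_spanP; exists (fun i => c i - d i).
by rewrite -sumrB; apply: eq_bigr => i _; rewrite scalerBl.
Qed.

Lemma combination_widen v k l c : (k <= l)%N ->
  \sum_(i < k) c i *: v i = \sum_(i < l) (if (i < k)%N then c i else 0) *: v i.
Proof.
move=> kl; rewrite (big_ord_widen l (fun i => c i *: v i) kl) big_mkcond.
by apply: eq_bigr => i _; case: ifP; rewrite ?scale0r.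
Qed.

Lemma mem_int_span v k i : (i < k)%N -> v i \in int_span v k.
Proof.
move=> ik; apply/int_spanP; exists (fun j => (j == i)%:R).
rewrite (bigD1 (Ordinal ik)) //= eqxx scale1r big1 ?addr0 // => j.
by rewrite -val_eqE /= => /negPf ->; rewrite scale0r.
Qed.

Lemma sub_int_span v k l u : (k <= l)%N -> u \in int_span v k -> u \in int_span v l.
Proof. move=> kl /int_spanP[c ->]; rewrite (combination_widen _ _ kl); apply/int_spanP.
by exists (fun i => if (i < k)%N then c i else 0).
Qed.

Lemma independent_span v l i k : independent v l -> (i < l)%N -> (0 < k)%N ->
  v i *+ k \notin int_span v i.
Proof.
move=> indv il k0; apply/int_spanP => -[c vE].
pose c' j : int := if (j < i)%N then c j else if j == i then - k%:Z else 0.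
suff /indv/(_ i il)/eqP : \sum_(j < l) c' j *: v j = 0.
  by rewrite /c' ltnn eqxx oppr_eq0; case: (k) k0.
rewrite /c' (bigID (fun j : 'I_l => (j < i)%N)) /=.
rewrite [X in X + _](_ : _ = v i *+ k); last first.
  rewrite vE (combination_widen _ _ (ltnW il)) big_mkcond.
  by apply: eq_bigr => j _; case: (j < i)%N; rewrite ?scale0r.
rewrite (bigD1 (Ordinal il)) /= ?ltnn // eqxx scaleNr big1 ?addr0.
  by rewrite -scaler_nat natz subrr.
move=> j /andP[/negPf -> ]; rewrite -val_eqE /= => /negPf ->.
by rewrite scale0r.
Qed.

(** If no standard basis vector could be added, then each of them would be a
    rational combination of the k given vectors, and the r by r identity matrix
    would have rank at most k. *)
Lemma extend_independent v k : independent v k -> (k < r)%N ->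
  exists w, (forall i, (i < k)%N -> w i = v i) /\ independent w k.+1.
Proof.
move=> indv kr; apply: contrapT => now.
have dep (j : 'I_r) : exists c : nat -> int, exists2 d : int, d != 0 &
    \sum_(i < k) c i *: v i + d *: delta_mx j 0 = 0.
  apply: contrapT => nodep; apply: now.
  pose w i := if (i < k)%N then v i else delta_mx j 0.
  exists w; split=> [i ik|c]; first by rewrite /w ik.
  rewrite big_ord_recr /= {2}/w ltnn.
  rewrite (eq_bigr (fun i : 'I_k => c i *: v i)) => [c0|i _]; last by rewrite /w ltn_ord.
  have ck : c k = 0 by apply/eqP; apply: contraT => ck0; case: nodep; exists c, (c k).
  move=> i; rewrite ltnS leq_eqVlt => /orP[/eqP -> //|]; apply: indv.
  by move: c0; rewrite ck scale0r addr0.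
pose F j := cid (dep j); pose c j := sval (F j).
have dP j : exists2 d : int, d != 0 & \sum_(i < k) c j i *: v i + d *: delta_mx j 0 = 0.
  exact: (svalP (F j)).
pose d j := s2val (cid2 (dP j)).
have d0 j : d j != 0 by rewrite /d; case: cid2.
have dE j : \sum_(i < k) c j i *: v i = - (d j *: delta_mx j 0).
  by apply/eqP; rewrite -addr_eq0 /d; case: cid2 => /= x _ ->.
pose M : 'M[rat]_(r, k) := \matrix_(l, i) (v i l 0)%:~R.
pose C : 'M[rat]_(k, r) := \matrix_(i, j) (c j i)%:~R.
pose D : 'rV[rat]_r := \row_j (- d j)%:~R.
have MC : M *m C = diag_mx D.
  apply/matrixP => l j; rewrite !mxE.
  have /colP/(_ l) := dE j; rewrite summxE !mxE => /(congr1 (intr : int -> rat)).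
  rewrite rmorph_sum /= => sE.
  transitivity ((- (d j * ((l == j) && (0 == 0 :> 'I_1))%:R))%:~R : rat).
    by rewrite -sE; apply: eq_bigr => i _; rewrite !mxE -intrM mulrC.
  rewrite eqxx andbT eq_sym; case: eqP => [->|_]; last by rewrite mulr0 oppr0.
  by rewrite mulr1.
have rk : \rank (diag_mx D) = r.
  apply/eqP; rewrite -/(row_free _) row_free_unit unitmxE det_diag unitfE.
  by apply/prodf_neq0 => j _; rewrite mxE intr_eq0 oppr_eq0.
have := leq_trans (mxrankM_maxr M C) (rank_leq_row C).
by rewrite MC rk leqNgt kr.
Qed.

Lemma complete_independent v k : independent v k -> (k <= r)%N ->
  exists w, (forall i, (i < k)%N -> w i = v i) /\ independent w r.
Proof.
move=> indv kr; suff H m : (k + m <= r)%N ->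
    exists w, (forall i, (i < k)%N -> w i = v i) /\ independent w (k + m).
  by have := H (r - k)%N; rewrite subnKC //; apply.
elim: m => [|m IHm] kmr; first by exists v; rewrite addn0.
rewrite addnS in kmr *; have [w [wv indw]] := IHm (ltnW kmr).
have [w' [ww' indw']] := extend_independent indw kmr; exists w'; split=> // i ik.
by rewrite ww' ?wv // (leq_trans ik) // leq_addr.
Qed.

Lemma nonroot (p : {poly int}) : p != 0 -> exists t : int, p.[t] != 0.
Proof.
move=> p0; apply: contrapT => rootp.
suff /(max_poly_roots p0) : all (root p) [seq k%:Z | k <- iota 0 (size p)].
  rewrite map_inj_uniq ?iota_uniq; last by move=> a b [].
  by rewrite size_map size_iota ltnn => /(_ isT).
by apply/allP => t _; apply/eqP; apply: contrapT => /eqP pt; apply: rootp; exists t.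
Qed.

(** Let q d be the polynomial whose coefficients are the coordinates of index at
    least n, in the basis v, of d times the determinant of that basis.  It
    vanishes exactly on the saturation of the span of the first n vectors, so
    it is nonzero on ds, and evaluating q at an integer that is not a root of
    the finitely many polynomials q d gives the form. *)
Lemma separating_form v n (ds : seq 'cV[int]_r) :
    independent v r -> (n <= r)%N ->
    (forall d, d \in ds -> forall k : int, k != 0 -> k *: d \notin int_span v n) ->
  exists h : 'cV[int]_r -> int,
    [/\ forall x y, h (x - y) = h x - h y, forall x, x \in int_span v n -> h x = 0
      & forall d, d \in ds -> h d != 0].
Proof.
move=> indv nr dsP; pose V : 'M[int]_r := \matrix_(l, i) v i l 0.
have VE (c : nat -> int) : V *m (\col_(i < r) c i) = \sum_(i < r) c i *: v i.
  apply/colP => l; rewrite mxE summxE; apply: eq_bigr => i _.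
  by rewrite !mxE mulrC.
have colE (x : 'cV[int]_r) : exists c : nat -> int, x = \col_(j < r) c j.
  exists (fun j => oapp (x^~ 0) 0 (insub j)); apply/colP => j.
  by rewrite mxE insubT //= => jr; congr (x _ 0); apply: val_inj.
have detV : \det V != 0.
  rewrite -det_tr; apply/det0P => -[x x0 xV]; case/eqP: x0; apply/rowP => i.
  have [c xE] := colE x^T.
  have := indv c; rewrite -VE -xE -[V]trmxK -trmx_mul xV trmx0 => /(_ erefl i (ltn_ord i)).
  by have /colP/(_ i) := xE; rewrite !mxE => ->.
(* Coordinates in the basis v, cleared of the denominator det V. *)
have [co coE] : exists co : 'cV[int]_r -> 'cV[int]_r, forall u, co u = \adj V *m u.
  by exists (mulmx (\adj V)).
pose q u : {poly int} := rVpoly (\row_(i < r) (if (n <= i)%N then co u i 0 else 0)).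
have qB x y : q (x - y) = q x - q y.
  rewrite -linearB; congr rVpoly; apply/rowP => i; rewrite !mxE !coE mulmxBr [in LHS]mxE -!coE.
  by case: ifP => _; rewrite ?subr0 // !mxE.
have q_span x : x \in int_span v n -> q x = 0.
  move=> /int_spanP[c]; rewrite (combination_widen _ _ nr) => xE.
  rewrite /q (_ : \row_i _ = 0) ?linear0 //; apply/rowP => i; rewrite !mxE.
  case: leqP => // ni; rewrite coE xE -(VE (fun i => if (i < n)%N then c i else 0)).
  by rewrite mulmxA mul_adj_mx mul_scalar_mx !mxE ltnNge ni mulr0.
have q_ds d : d \in ds -> q d != 0.
  move=> /dsP/(_ _ detV); apply: contraNneq => qd0; apply/int_spanP.
  have co0 (i : 'I_r) : (n <= i)%N -> co d i 0 = 0.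
    move=> ni; have := congr1 (fun p : {poly int} => p`_i) qd0.
    by rewrite coef_rVpoly_ord mxE ni coef0.
  have [c cE] := colE (co d); exists c.
  rewrite (combination_widen _ _ nr) -mul_scalar_mx -mul_mx_adj -mulmxA -coE cE VE.
  apply: eq_bigr => i _; case: ltnP => // /co0.
  by rewrite cE mxE => ->.
have [|t] := @nonroot (\prod_(d <- ds) q d).
  by rewrite prodf_seq_neq0; apply/allP => d /q_ds ->.
rewrite horner_prod prodf_seq_neq0 => /allP tP.
exists (fun u => (q u).[t]); split=> [x y|x /q_span ->|d /tP //].
  by rewrite qB hornerD hornerN.
by rewrite horner0.
Qed.

End IndependentVectors.

(** * Primality, height and dimension *)

Section TwistedPrime.
Variables (K : finFieldType) (r : nat) (L : {pred 'cV[int]_r}) (HL : zmod_closed L).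
Variable P : torus K r.
Local Notation S := {mpoly K[r]}.
Local Notation F := (class_sum L P).

(** In the convolution product of f and g, the classes on which f has class sum
    zero may be dropped: modulo the ideal, f equals the sum of its other
    terms. *)
Lemma class_sumM_reduced (f g : S) z : F z (f * g) =
  \sum_(m <- msupp f | F (expvec m) f != 0)
     f@_m * (laurent_mon (expvec m) P * F (z - expvec m) g).
Proof.
pose f' : S := \sum_(m <- msupp f | F (expvec m) f != 0) f@_m *: 'X_[m].
have f'E z' : F z' f' = F z' f.
  rewrite /f' linear_sum /=.
  transitivity (\sum_(m <- msupp f | (expvec m - z' \in L) && (F (expvec m) f != 0))
                  f@_m * laurent_mon (expvec m) P).
    rewrite big_mkcondl; apply: eq_bigr => m _; rewrite linearZ_LR /= class_sumX.
    by case: ifP; rewrite ?mulr0.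
  rewrite [RHS]/class_sum; case: (eqVneq (F z' f) 0) => [f0|fn0].
    rewrite big_pred0 => [|m]; first by rewrite -[LHS]f0.
    by case Lm: (_ \in L) => //=; rewrite (class_sum_congr HL _ _ Lm) f0 eqxx.
  by apply: eq_bigl => m; case Lm: (_ \in L) => //=; rewrite (class_sum_congr HL _ _ Lm) fn0.
have -> : F z (f * g) = F z (f' * g).
  apply/eqP; rewrite -subr_eq0 -linearB -mulrBl mulrC; apply/eqP.
  have [_ _ idM] := class_sum_ideal L P; apply: idM => z'.
  by rewrite linearB /= f'E subrr.
rewrite /f' mulr_suml linear_sum; apply: eq_bigr => m _ /=.
by rewrite -scalerAl linearZ_LR /= -class_sumMX ['X_[_] * g]mulrC.
Qed.

Lemma exists_max (T : eqType) (s : seq T) (Q : pred T) (h : T -> int) : has Q s ->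
  exists m, [/\ m \in s, Q m & forall x, x \in s -> Q x -> h x <= h m].
Proof.
elim: s => //= a s IHs; case: (boolP (has Q s)) => [/IHs[m [ms Qm maxm]] _|nQs].
  case: (boolP (Q a && (h m <= h a))) => [/andP[Qa ma]|].
    exists a; split=> //; first exact: mem_head.
    move=> x; rewrite inE => /orP[/eqP -> //|xs Qx].
    exact: Order.POrderTheory.le_trans (maxm _ xs Qx) ma.
  rewrite negb_and => nQa; exists m; split=> //; first by rewrite inE ms orbT.
  move=> x; rewrite inE => /orP[/eqP -> Qa|]; last exact: maxm.
  by move: nQa; rewrite Qa /= -Order.TotalTheory.ltNge => /Order.POrderTheory.ltW.
rewrite orbF => Qa; exists a; split=> //; first exact: mem_head.
move=> x; rewrite inE => /orP[/eqP -> //|xs Qx].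
by case/hasP: nQs; exists x.
Qed.

Lemma class_sum_reps (f : S) : ~ (forall z, F z f = 0) ->
  has (fun m => F (expvec m) f != 0) (msupp f).
Proof.
move=> /existsNP[z /eqP fz]; have [m mf Lm] := class_sum_supp fz.
by apply/hasP; exists m => //; rewrite (class_sum_congr HL _ _ Lm).
Qed.

(** When additive forms separate any finitely many classes, the group algebra of
    Z^r / L is a domain.  Choose a form h with distinct values on the classes met
    by f.  Among the classes where f,
    respectively g, has a nonzero class sum, take one where h is maximal; the
    class sum of f g at the sum of the two is the product of the two maximal
    class sums, no other pair of classes contributing to it. *)
Lemma twisted_prime :
    (forall ds : seq 'cV[int]_r, (forall d, d \in ds -> d \notin L) ->
       exists h : 'cV[int]_r -> int,
         [/\ forall x y, h (x - y) = h x - h y, forall x, x \in L -> h x = 0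
           & forall d, d \in ds -> h d != 0]) ->
  prime_ideal (twisted_lattice_ideal L P).
Proof.
move=> sep; split; first exact: ideal_gen_ideal.
  rewrite twisted_lattice_idealE // => /(_ 0); rewrite -[1]mpolyX0 class_sumX.
  rewrite (_ : expvec _ = 0 :> 'cV[int]_r); last by apply/colP => i; rewrite !mxE mnm0E.
  rewrite subr0; have [-> _] := HL.
  by rewrite laurent_mon0 => /eqP; rewrite oner_eq0.
move=> f g; rewrite twisted_lattice_idealE // => fg0.
apply: contrapT => /not_orP[/class_sum_reps hf /class_sum_reps hg].
pose ds := [seq d <- [seq expvec m - expvec m' | m <- msupp f, m' <- msupp f] | d \notin L].
have [|h [hB hL hds]] := sep ds; first by move=> d; rewrite mem_filter => /andP[].
have [m1 [m1f nz1 max1]] := exists_max (h \o @expvec r) hf.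
have [m2 [m2g nz2 max2]] := exists_max (h \o @expvec r) hg.
have hD x y : h (x + y) = h x + h y.
  have h0 : h 0 = 0 by apply: hL; have [] := HL.
  by rewrite -[y in LHS]opprK -[- y]sub0r !hB h0 sub0r opprK.
have := fg0 (expvec m1 + expvec m2); rewrite class_sumM_reduced.
have cancel_m m : expvec m - expvec m1 \in L ->
    F (expvec m1 + expvec m2 - expvec m) g = F (expvec m2) g.
  move=> Lm; apply: class_sum_congr => //.
  by rewrite addrAC addrK -opprB -sub0r; have [L0 LB] := HL; apply: LB.
rewrite (_ : \sum_(m <- _ | _) _ = F (expvec m1) f * F (expvec m2) g).
  by move=> /eqP; rewrite mulf_eq0 (negPf nz1) (negPf nz2).
rewrite [X in _ = X * _]/class_sum mulr_suml big_seq_cond [RHS]big_seq_cond.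
rewrite big_mkcond [RHS]big_mkcond; apply: eq_bigr => m _.
case mf: (m \in msupp f) => //=.
case Lm: (expvec m - expvec m1 \in L).
  by rewrite (class_sum_congr HL _ _ Lm) nz1 cancel_m // mulrA.
case: ifP => // nz; rewrite (_ : F _ g = 0) ?mulr0 //; apply/eqP; apply: contraFT Lm => gz.
have [m' m'g Lm'] := class_sum_supp gz.
have hm : h (expvec m - expvec m1) = 0.
  have gm' : F (expvec m') g != 0 by rewrite (class_sum_congr HL _ _ Lm').
  have le1 := max1 _ mf nz; have le2 := max2 _ m'g gm'.
  have := hL _ Lm'; rewrite !hB hD /= in le1 le2 * => hm'.
  by apply: Order.POrderTheory.le_anti; apply/andP; split; lia.
apply: contraT => nLm; suff : h (expvec m - expvec m1) != 0 by rewrite hm eqxx.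
by apply: hds; rewrite mem_filter nLm; apply/allpairsP; exists (m, m1).
Qed.

End TwistedPrime.

Section Heights.
Variables (K : finFieldType) (n r : nat) (phi : 'M[int]_(r, n)).
Variables (A : zmodType) (beta : {additive 'cV[int]_r -> A}).
Hypothesis hseq : class_group_sequence phi beta.
Local Notation S := {mpoly K[r]}.
Local Notation L := (Lbeta beta).
Implicit Types (P Q : torus K r) (v : nat -> 'cV[int]_r).

Definition evaluation_ideal P : set S := fun f => f.@[fun i => val (P i)] = 0.

Lemma evaluation_ideal_prime P : prime_ideal (evaluation_ideal P).
Proof.
rewrite /evaluation_ideal; split; first split.
- exact: meval0.
- by move=> f g f0 g0; rewrite mevalD f0 g0 addr0.
- by move=> h f f0; rewrite mevalM f0 mulr0.
- by rewrite meval1 => /eqP; rewrite oner_eq0.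
- by move=> f g /eqP; rewrite mevalM mulf_eq0 => /orP[]/eqP; [left|right].
Qed.

Lemma twisted_sub_evaluation (M : {pred 'cV[int]_r}) P :
  (twisted_lattice_ideal M P `<=` evaluation_ideal P)%classic.
Proof.
apply: ideal_gen_min => [|_ [u _ ->]]; first by have [] := evaluation_ideal_prime P.
rewrite /evaluation_ideal mevalB mevalZ !meval_expvec -laurent_monD -{2}(expvec_parts u).
by rewrite subrK subrr.
Qed.

(** The binomial of v i belongs to the twisted ideal of the lattice spanned by
    the first i + 1 vectors and is regular modulo that of the first i, because
    v i has infinite order modulo their span. *)
Lemma span_prime_chain v k (a b : nat) P (p : set S) :
    independent v k -> (a + b <= k)%N -> prime_ideal p ->
    (twisted_lattice_ideal (int_span v (a + b)) P `<=` p)%classic ->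
  exists c, [/\ prime_chain c b, c b = p
    & (twisted_lattice_ideal (int_span v a) P `<=` c 0%N)%classic].
Proof.
move=> indv abk; pose J i : set S := twisted_lattice_ideal (int_span v i) P.
pose h i : S := 'X_[pos_part (v i)] - laurent_mon (v i) P *: 'X_[neg_part (v i)].
apply: (@prime_chain_of_regular _ J h) => i; first by move=> _; apply: ideal_gen_ideal.
move=> /andP[ai ib]; split.
- apply: ideal_gen_min; first exact: ideal_gen_ideal.
  move=> _ [u iu ->]; apply: mem_ideal_gen; exists u => //.
  exact: sub_int_span (leqnSn i) iu.
- by apply: mem_ideal_gen; exists (v i) => //; apply: mem_int_span.
- move=> s; apply: binomial_regular; first exact: int_span_closed.
  by move=> m m0; apply: (independent_span indv (leq_trans ib abk) m0).
Qed.

(** The bound n <= r is itself a consequence of dimension theory: n independent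
    columns give a chain of n strict inclusions of primes. *)
Lemma columns_basis : (n <= r)%N /\ exists v, independent v r /\ L =i int_span v n.
Proof.
pose v (i : nat) : 'cV[int]_r := oapp (fun j => col j phi) 0 (insub i).
have vE (c : nat -> int) : \sum_(i < n) c i *: v i = phi *m (\col_(i < n) c i).
  apply/colP => l; rewrite summxE mxE; apply: eq_bigr => i _.
  by rewrite /v insubT //= => ni; rewrite !mxE mulrC; congr (phi _ _ * _); apply: val_inj.
have indv : independent v n.
  move=> c; rewrite vE => c0 i ni; have [inj _ _] := hseq.
  have cE : \col_(i < n) c i = 0 by apply: inj; rewrite c0 mulmx0.
  have := congr1 (fun x : 'cV[int]_n => x (Ordinal ni) 0) cE.
  by rewrite !mxE.
have nr : (n <= r)%N.
  pose Q : torus K r := 1%g.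
  have [//||c [prc _ _]] := @span_prime_chain v n 0 n Q _ indv _ (evaluation_ideal_prime Q).
    exact: twisted_sub_evaluation.
  exact: prime_chain_mpoly_le prc.
split=> //; have [w [wv indw]] := complete_independent indv nr.
exists w; split=> // u; apply/(LbetaP hseq)/int_spanP => -[c ->].
  pose c' i := oapp (c^~ 0) 0 (insub i); exists c'.
  rewrite (eq_bigr (fun i : 'I_n => c' i *: v i)) => [|i _]; last by rewrite wv.
  rewrite vE; congr (_ *m _); apply/colP => i.
  by rewrite !mxE /c' insubT //= => ni; congr (c _ 0); apply: val_inj.
by exists (\col_(i < n) c i); rewrite -vE; apply: eq_bigr => i _; rewrite wv.
Qed.

Lemma twisted_eq_mem (M M' : {pred 'cV[int]_r}) P : M =i M' ->
  twisted_lattice_ideal M P = twisted_lattice_ideal M' P.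
Proof.
move=> MM'; congr ideal_gen; apply/seteqP.
by split=> f [m Mm ->]; exists m => //; rewrite ?MM' // -MM'.
Qed.

Lemma chain_below P (p : set S) : prime_ideal p ->
    (twisted_lattice_ideal L P `<=` p)%classic ->
  exists c, prime_chain c n /\ c n = p.
Proof.
have [nr [v [indv Lv]]] := columns_basis; move=> prp.
rewrite (twisted_eq_mem _ Lv) => Lp.
by have [c [prc cn _]] := @span_prime_chain v r 0 n P p indv nr prp Lp; exists c.
Qed.

(** The descent starts from the prime of the polynomials vanishing at P, which
    contains all the ideals of the filtration. *)
Lemma chain_above P : exists c,
  prime_chain c (r - n) /\ (twisted_lattice_ideal L P `<=` c 0%N)%classic.
Proof.
have [nr [v [indv Lv]]] := columns_basis.
have [||c [prc _ cn]] := @span_prime_chain v r n (r - n) P _ indv _ (evaluation_ideal_prime P).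
- by rewrite subnKC.
- exact: twisted_sub_evaluation.
by exists c; rewrite (twisted_eq_mem _ Lv).
Qed.

Section NonEmpty.
Variables (Y : {set TX K phi}) (Y0 : Y != set0).
Local Notation I := (vanishing_ideal beta Y).

Lemma vanishing_sub_point P : pt phi P \in Y -> (I `<=` twisted_lattice_ideal L P)%classic.
Proof.
move=> YP; rewrite -(vanishing_ideal_twisted hseq) (vanishing_ideal_bigcap hseq).
by move=> f; apply.
Qed.

Lemma point_below_prime (p : set S) : prime_ideal p -> (I `<=` p)%classic ->
  exists P, (twisted_lattice_ideal L P `<=` p)%classic.
Proof.
move=> prp; rewrite (vanishing_ideal_bigcap hseq) => Ip.
have [//|//|C _|C _ Cp] := bigcap_sub_graded_prime _ _ (graded_prime_all prp) _ Ip.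
  exact/homogeneous_ideal_all/ideal_gen_ideal.
have [P PC] := pt_surj C; exists P.
by rewrite -(vanishing_ideal_twisted hseq) PC.
Qed.

(** Below the bottom of the chain fits a chain of length n, and the two together
    cannot exceed the dimension of the polynomial ring. *)
Lemma chain_bound (c : nat -> set S) k : prime_chain c k -> (I `<=` c 0%N)%classic ->
  (n + k <= r)%N.
Proof.
move=> prc Ic; have [P Pc] := point_below_prime (prc.1 0%N (leq0n _)) Ic.
have [c' [prc' c'n]] := chain_below (prc.1 0%N (leq0n _)) Pc.
have [d [prd _ _]] := prime_chain_cat prc' prc c'n.
exact: prime_chain_mpoly_le prd.
Qed.

Lemma chain_above_vanishing : exists c, prime_chain c (r - n) /\ (I `<=` c 0%N)%classic.
Proof.
have /set0Pn[C YC] := Y0; have [P PC] := pt_surj C.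
have [c [prc Pc]] := chain_above P; exists c; split=> //.
by apply: classical_sets.subset_trans Pc; apply: vanishing_sub_point; rewrite PC.
Qed.

(** The prime of height n is the bottom of a chain of length r - n: a chain below
    it of length greater than n would exceed r when continued upwards. *)
Lemma vanishing_height : height_is I n.
Proof.
split; last first.
  move=> p k prp Ip [_ pk]; have [P Pp] := point_below_prime prp Ip.
  by have [c [prc cp]] := chain_below prp Pp; apply: pk prc cp.
have [c [prc Ic]] := chain_above_vanishing; have pr0 := prc.1 0%N (leq0n _).
exists (c 0%N); split=> //; split.
  have [P Pc] := point_below_prime pr0 Ic.
  by have [c' [prc' c'n]] := chain_below pr0 Pc; exists c'.
move=> c' k prc' c'k; have [d [prd _ _]] := prime_chain_cat prc' prc c'k.
have := prime_chain_mpoly_le prd; have [nr _] := columns_basis.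
by lia.
Qed.

Lemma vanishing_dim : quotient_krull_dim_is I (r - n).
Proof.
have /set0Pn[C YC] := Y0; have [P PC] := pt_surj C.
apply: quotient_krull_dim; first exact: ideal_gen_ideal.
- rewrite -PC in YC; move=> /(vanishing_sub_point YC)/twisted_sub_evaluation.
  by have [] := evaluation_ideal_prime P.
- exact: chain_above_vanishing.
- by move=> c k prc Ic; have := chain_bound prc Ic; lia.
Qed.

End NonEmpty.

Lemma torsion_free_prime P : torsion_free A -> prime_ideal (twisted_lattice_ideal L P).
Proof.
move=> tf; apply: twisted_prime; first exact: Lbeta_closed.
have [nr [v [indv Lv]]] := columns_basis.
move=> ds dsL; have [|h [hB hL hds]] := separating_form indv nr (ds := ds).
  move=> d /dsL dL k k0; rewrite -Lv; apply: contra dL; rewrite !inE => /eqP dk.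
  apply/eqP; apply: tf; exists `|k|%N; first by rewrite absz_gt0.
  have : beta d *~ k = 0 by rewrite -raddfMz -scaler_int intz.
  by case: (k) => m; rewrite ?NegzE ?mulrNz -?pmulrn // => /eqP; rewrite oppr_eq0 => /eqP.
by exists h; split=> // x; rewrite Lv; apply: hL.
Qed.

End Heights.

(** * Radicality, decomposition, height and dimension of I(Y) *)

Section VanishingRadical.
Variables (K : finFieldType) (n r : nat) (phi : 'M[int]_(r, n)).
Variables (A : zmodType) (beta : {additive 'cV[int]_r -> A}) (N : nat).
Hypothesis hseq : class_group_sequence phi beta.
Hypothesis hN : torsion_order_is A N.
Hypothesis hchar : forall p : nat, p \in [pchar K] -> coprime N p.

Lemma vanishing_ideal_radical (Y : {set TX K phi}) :
  is_radical (vanishing_ideal beta Y).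
Proof.
apply/seteqP; split=> [f [k]|f fY]; last by exists 1%N; rewrite expr1.
rewrite (vanishing_ideal_bigcap hseq) => fk C YC; have := fk C YC.
have [P <-] := pt_surj C; rewrite (vanishing_ideal_twisted hseq).
have [p pr_p pK] := finPcharP K.
apply: (twisted_radical (Lbeta_closed beta) pK) => u; rewrite !inE raddfMn => /eqP up.
by rewrite (torsion_coprime hN (prime_gt0 pr_p) (hchar pK) up).
Qed.

End VanishingRadical.

Theorem theorem5p1 (R : realType) (K : finFieldType) (n r : nat)
    (phi : 'M[int]_(r, n)) (Sigma : {set {set 'I_r}})
    (A : zmodType) (beta : {additive 'cV[int]_r -> A}) (N : nat)
    (hfan : complete_simplicial_fan R phi Sigma)
    (hseq : class_group_sequence phi beta)
    (hN : torsion_order_is A N)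
    (hchar : forall p : nat, p \in [pchar K] -> coprime N p)
    (Y : {set TX K phi}) (P : torus K r) :
  [/\ (* (i) *)
      forall L : zmodClosed 'cV[int]_r,
        vanishing_ideal beta Y = lattice_ideal L ->
        vanishing_ideal beta (translate (pt phi P) Y) =
          twisted_lattice_ideal L P,
      (* (ii) *)
      [/\ vanishing_ideal beta [set pt phi P]%SET =
            twisted_lattice_ideal (Lbeta beta) P,
          graded_prime_ideal (homogeneous K beta)
            (vanishing_ideal beta [set pt phi P]%SET),
          torsion_free A ->
            prime_ideal (vanishing_ideal beta [set pt phi P]%SET)
        & height_is (vanishing_ideal beta [set pt phi P]%SET) n],
      (* (iii) *)
      the_minimal_graded_primary_decomposition (homogeneous K beta)
        Y (fun C => vanishing_ideal beta [set C]%SET) (vanishing_ideal beta Y) /\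
      (torsion_free A ->
       the_minimal_primary_decomposition
        Y (fun C => vanishing_ideal beta [set C]%SET) (vanishing_ideal beta Y)),
      (* (iv) *)
      is_radical (vanishing_ideal beta Y)
    & (* (v) and (vi) *)
      Y != set0 ->
      height_is (vanishing_ideal beta Y) n /\
      quotient_krull_dim_is (vanishing_ideal beta Y) (r - n)].
Proof.
have hrad Y' := vanishing_ideal_radical hseq hN hchar Y'.
have grprime (C : TX K phi) :
    graded_prime_ideal (homogeneous K beta) (vanishing_ideal beta [set C]%SET).
  by have [Q <-] := pt_surj C; apply: (graded_prime_point hseq).
have tfprime (C : TX K phi) :
    torsion_free A -> prime_ideal (vanishing_ideal beta [set C]%SET).
  have [Q <-] := pt_surj C; rewrite (vanishing_ideal_twisted hseq).
  exact: torsion_free_prime hseq Q.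
split.
- by move=> L; apply: vanishing_ideal_translate.
- split.
  + exact: vanishing_ideal_twisted.
  + exact: grprime.
  + exact: tfprime.
  + by apply: vanishing_height => //; apply/set0Pn; exists (pt phi P); rewrite inE.
- split=> [|tf].
  + apply: (the_minimal_decomposition_of_primes (homogeneous1 K beta)
      (@homogeneousM K r A beta)) => //.
    * move=> C _; have [hC nC prC] := grprime C; split=> // f g hf hg.
      by case/(prC _ _ hf hg) => [|gC]; [left|right; exists 1%N; rewrite expr1].
    * by move=> C _; rewrite /graded_radical hrad -homogeneous_ideal_vanishing.
    * by move=> C D _ _; apply: separate_points.
    * exact: vanishing_ideal_bigcap.
  + apply: (@the_minimal_decomposition_of_primes _
      (classical_sets.setT : set {mpoly K[r]})) => //.
    * exact: graded_primary_all.
    * move=> C _; have [idC nC prC] := tfprime C tf; split=> // f g /prC[]; first by left.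
      by right; exists 1%N; rewrite expr1.
    * by move=> C _; apply: hrad.
    * by move=> C _; apply: graded_prime_all; apply: tfprime.
    * by move=> C D _ _ /(separate_points hseq)[f [_ fC fD]]; exists f.
    * exact: vanishing_ideal_bigcap.
- exact: hrad.
- by move=> Y0; split; [apply: vanishing_height|apply: vanishing_dim].
Qed.
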